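(* Let $\mathcal{H}$ be a real Hilbert space and $M:\mathcal{H}\to\mathcal{H}$ a monotone and continuous operator with $\mathrm{Zer}\,M\neq\emptyset$. Let $t_0\ge0$, $x_0\in\mathcal{H}$, let $\varepsilon:[t_0,+\infty)\to(0,+\infty)$ be continuously differentiable with $$\lim_{t\to+\infty}\varepsilon(t)=0\quad\text{and}\quad\int_{t_0}^{+\infty}\varepsilon(t)\,dt=+\infty,$$ and let $x:[t_0,+\infty)\to\mathcal{H}$ be the trajectory solution of $$\dot x(t)+M(x(t))+\varepsilon(t)x(t)=0,\qquad x(t_0)=x_0 .$$ Set $$\gamma_\varepsilon(t):=\exp\left(\int_{t_0}^t\varepsilon(u)\,du\right),\qquad \varepsilon_i:=\inf_{t\ge t_0}\frac{-\dot\varepsilon(t)}{\varepsilon^2(t)},\qquad \varepsilon_s:=\sup_{t\ge t_0}\frac{-\dot\varepsilon(t)}{\varepsilon^2(t)} .$$ Suppose that $$1<\varepsilon_i\quad\text{or}\quad -1<\varepsilon_i\le\varepsilon_s<1\quad\text{or}\quad\varepsilon_i=\varepsilon_s=1 .$$ Then the following statements are true: (i) as $t\to+\infty$ it holds: if $1<\varepsilon_i$ or $\varepsilon_i=\varepsilon_s=1$, then $\|\dot x(t)\|=\mathcal{O}\left(\frac{1}{\gamma_\varepsilon(t)}\right)$ and $\|M(x(t))\|=\mathcal{O}\left(\frac{1}{\gamma_\varepsilon(t)}\right)$; if $-1<\varepsilon_i\le\varepsilon_s<1$, then $\|\dot x(t)\|=\mathcal{O}(\varepsilon(t))$ and $\|M(x(t))\|=\mathcal{O}(\varepsilon(t))$;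 (ii) $x(t)$ converges strongly to the minimum norm solution $\xi_*:=P_{\mathrm{Zer}\,M}(0)$ as $t\to+\infty$.
   Context: $M$ is monotone if $\langle M(x)-M(y),x-y\rangle\ge 0$ for all $x,y\in\mathcal{H}$. $\mathrm{Zer}\,M:=\{x\in\mathcal{H}: M(x)=0\}$, which is closed and convex; $P_{\mathrm{Zer}\,M}$ is the metric projection onto it. It is assumed that the system admits a unique strong global solution, i.e. a function $x:[t_0,+\infty)\to\mathcal{H}$ that is absolutely continuous on every compact interval $[t_0,T]$, satisfies the equation almost everywhere and the initial condition, and for which moreover $t\mapsto M(x(t))$ is absolutely continuous on every compact interval $[t_0,T]$; this is ''the trajectory solution''. Estimates involving $\dot x(t)$ are understood for almost every $t$. *)

(* Defs.v *)
From HB Require Import structures.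
From mathcomp Require Import all_boot all_order all_algebra.
From mathcomp Require Import all_classical all_reals all_analysis.

Set Implicit Arguments.
Unset Strict Implicit.
Unset Printing Implicit Defensive.

Import Order.TTheory GRing.Theory Num.Theory.
Import numFieldNormedType.Exports.

Local Open Scope classical_set_scope.
Local Open Scope ring_scope.

(* Lets the library's Landau notation [f =O_ F g] be used for [F] = +oo. *)
Canonical pinfty_filter_on (R : realType) :=
  FilterType (pinfty_nbhs R) _.

Section operators.
Context {R : realType} {H : completeNormedModType R}.

(* [dot] is the inner product that induces the norm of [H]; together with the
   completeness of [H] this makes [H] a real Hilbert space. *)
Definition norm_induced_by (dot : {dot H for idfun}) : Prop :=
  forall u : H, `|u| ^+ 2 = dot u u.

Definition monotone_op (dot : {dot H for idfun}) (M : H -> H) : Prop :=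
  forall u v : H, 0 <= dot (M u - M v) (u - v).

Definition Zer (M : H -> H) : set H := [set z | M z = 0].

(* The point of [C] nearest to [u]. It exists and is unique when [C] is a
   nonempty closed convex subset of a Hilbert space; the default value [u] is
   used only if there is no nearest point. *)
Definition metric_proj (C : set H) (u : H) : H :=
  xget u [set p | C p /\ forall z, C z -> `|u - p| <= `|u - z|].

End operators.

Section real_variable.
Context {R : realType} {V : normedModType R}.

(* Limit of the difference quotients at [t] along points of [A] only: it is
   the usual derivative at interior points of [A], the one-sided derivative at
   an endpoint, and it does not depend on the values of [f] outside [A]. *)
Definition quotients_within (A : set R) (f : R -> V) (t : R) : set_system V :=
  (fun s => (s - t)^-1 *: (f s - f t)) @ within A t^'.

Definition derive_within (A : set R) (f : R -> V) (t : R) : V :=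
  lim (quotients_within A f t).

Definition continuously_differentiable_on (A : set R) (f : R -> V) : Prop :=
  (forall t, A t -> cvg (quotients_within A f t)) /\
  {within A, continuous (derive_within A f)}.

Definition absolutely_continuous_on (a b : R) (f : R -> V) : Prop :=
  forall e : R, 0 < e -> exists2 d : R, 0 < d &
    forall (n : nat) (l r : 'I_n -> R),
      (forall i, a <= l i /\ l i <= r i /\ r i <= b) ->
      trivIset [set: 'I_n] (fun i => `]l i, r i[%classic) ->
      \sum_(i < n) (r i - l i) < d ->
      \sum_(i < n) `|f (r i) - f (l i)| < e.

(* [f = O(g)] at +oo, where the bound is only required almost everywhere. *)
Definition ae_bigO (f : R -> V) (g : R -> R) : Prop :=
  exists C T : R,
    {ae @lebesgue_measure R, forall t, T <= t -> `|f t| <= C * `|g t|}.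

End real_variable.

Section system.
Context {R : realType} {H : completeNormedModType R}.
Implicit Types (M : H -> H) (eps : R -> R) (x : R -> H).

(* Functions on [t0, +oo) are represented by total functions; nothing below
   depends on their values before [t0]. *)
Definition strong_global_solution M eps (t0 : R) (x0 : H) x : Prop :=
  [/\ forall T, t0 <= T -> absolutely_continuous_on t0 T x,
      forall T, t0 <= T -> absolutely_continuous_on t0 T (M \o x),
      {ae @lebesgue_measure R, forall t, t0 <= t ->
        derivable x t 1 /\ derive1 x t + M (x t) + eps t *: x t = 0}
    & x t0 = x0].

Definition trajectory_solution M eps (t0 : R) (x0 : H) x : Prop :=
  strong_global_solution M eps t0 x0 x /\
  forall y, strong_global_solution M eps t0 x0 y ->
    {in `[t0, +oo[, y =1 x}.

Definition gamma_eps eps (t0 t : R) : R :=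
  expR (\int[@lebesgue_measure R]_(u in `[t0, t]) eps u).

Definition eps_ratio eps (t0 t : R) : R :=
  - derive_within `[t0, +oo[ eps t / eps t ^+ 2.

Definition eps_i eps (t0 : R) : \bar R :=
  ereal_inf [set (eps_ratio eps t0 t)%:E | t in `[t0, +oo[].

Definition eps_s eps (t0 : R) : \bar R :=
  ereal_sup [set (eps_ratio eps t0 t)%:E | t in `[t0, +oo[].

End system.

(* Main.v *)
Require Import Defs.
From HB Require Import structures.
From mathcomp Require Import all_boot all_order all_algebra.
From mathcomp Require Import all_classical all_reals all_analysis.
From mathcomp Require Import ring lra.

Set Implicit Arguments.
Unset Strict Implicit.
Unset Printing Implicit Defensive.

Import Order.TTheory GRing.Theory Num.Theory.
Import numFieldNormedType.Exports.

Local Open Scope classical_set_scope.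
Local Open Scope ring_scope.

(** The proof rests on two remarks about a trajectory [x], whose velocity is
    [v = - (M x + eps x)].

    The first is a differential inequality for the energy [|v|^2].  The
    function [M \o x] need not be differentiable, so the increments
    [x (t + h) - x t] are considered instead: monotonicity of [M] removes the
    operator from the derivative of their squared norm, and dividing by [h^2]
    and letting [h] tend to [0] bounds the upper right Dini derivative of
    [|v|^2] by [- 2 eps |v|^2 - 2 eps' <x, v>] (lemma [energy_dini]).  Since [x]
    is bounded, comparison with explicit supersolutions gives the rates:
    - if [eps_i > 1], [|v| <= A / gamma - D eps] for suitable [A] and [D];
    - if [-1 < eps_i] and [eps_s < 1], [|v| <= C eps];
    - if [eps_i = eps_s = 1], that is [eps' = - eps^2], the crude bound
      [|<x, v>| <= |x| |v|] would lose a logarithm; but [- 2 eps' <x, v> / eps^2]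
      is then the derivative of [|x|^2], so that [|v|^2 / eps^2 - |x|^2] is
      nonincreasing and again [|v| <= C eps], with [eps = O (1 / gamma)].
    The same bounds hold for [M x = - v - eps x], because [x] is bounded and
    [eps] is itself dominated by the rate.

    The second remark is that strong convergence needs only [M (x t) --> 0],
    which the rates provide.  The sets of all [c] with [|c| <= B],
    [<p, c> <= <p, p> - e] and [<M y, y - c> >= - (|y| + B) / n] for every [y]
    are closed, convex and decreasing in [n].  If [<p, x t - p> < - e] held for
    arbitrarily large [t], they would all be nonempty, hence they would have a
    common point, which is a zero of [M] by Minty's argument; this contradicts
    [<p, z - p> >= 0], valid for all zeros [z] when [p] is the zero of least
    norm.  So [<p, x t - p>] is eventually at least [- e], and
    [(gamma^2 (|x - p|^2 - e))' <= 0] concludes, since [gamma] tends to [+oo].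

    A preliminary step turns the almost everywhere equation into an everywhere
    one: an absolutely continuous function satisfies the mean value inequality
    as soon as its derivative is bounded almost everywhere, and [v] is
    continuous, so [x] is of class C^1 on the open half-line after [t0]. *)

(** * Inner product *)

Section inner_product.
Context {R : realType} {H : completeNormedModType R}.
Variable dot : {dot H for idfun}.
Hypothesis dot_norm : norm_induced_by dot.
Implicit Types u v w : H.

Lemma dotC u v : dot u v = dot v u.
Proof. by rewrite (hermitian_subproof u v)/= expr0 mul1r. Qed.

Lemma dotDl u v w : dot (u + v) w = dot u w + dot v w.
Proof. exact: linearDl. Qed.

Lemma dotDr u v w : dot u (v + w) = dot u v + dot u w.
Proof. exact: linearDr. Qed.

Lemma dotNl u v : dot (- u) v = - dot u v.
Proof. exact: linearNl. Qed.

Lemma dotNr u v : dot u (- v) = - dot u v.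
Proof. exact: linearNr. Qed.

Lemma dotZl (k : R) u v : dot (k *: u) v = k * dot u v.
Proof. exact: linearZl_LR. Qed.

Lemma dotZr (k : R) u v : dot u (k *: v) = k * dot u v.
Proof. by rewrite dotC dotZl dotC. Qed.

Definition dotE := (dotDl, dotDr, dotNl, dotNr, dotZl, dotZr).

Lemma sqr_normD u v : `|u + v| ^+ 2 = `|u| ^+ 2 + 2 * dot u v + `|v| ^+ 2.
Proof. by rewrite !dot_norm !dotE (dotC v u); ring. Qed.

Lemma sqr_normB u v : `|u - v| ^+ 2 = `|u| ^+ 2 - 2 * dot u v + `|v| ^+ 2.
Proof. by rewrite sqr_normD dotNr normrN mulrN. Qed.

(** Polarization reduces the continuity of the inner product to that of the
    norm. *)
Lemma dot_polar u v : dot u v = (`|u + v| ^+ 2 - `|u - v| ^+ 2) / 4.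
Proof. by rewrite sqr_normD sqr_normB; field. Qed.

(** Cauchy-Schwarz inequality, obtained by expanding
    [| |v| u - |u| v |^2 >= 0]. *)
Lemma dot_le u v : dot u v <= `|u| * `|v|.
Proof.
have [->|v0] := eqVneq v 0; first by rewrite normr0 mulr0 -(scale0r 0) dotZr mul0r.
have v1 : 0 < `|v| by rewrite normr_gt0.
have : 0 <= `|(`|v| *: u - `|u| *: v)| ^+ 2 by rewrite sqr_ge0.
rewrite sqr_normB !normrZ !normr_id !dotE => h.
have [->|u0] := eqVneq u 0; first by rewrite normr0 mul0r dotC -(scale0r 0) dotZr mul0r.
have u1 : 0 < `|u| by rewrite normr_gt0.
have : 0 <= (2 * (`|u| * `|v|)) * (`|u| * `|v| - dot u v) by nra.
by rewrite pmulr_rge0 ?subr_ge0// !mulr_gt0.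
Qed.

Lemma dot_ge u v : - (`|u| * `|v|) <= dot u v.
Proof. by rewrite lerNl -dotNl -(normrN u) dot_le. Qed.

Lemma parallelogram u v :
  `|u - v| ^+ 2 = 2 * `|u| ^+ 2 + 2 * `|v| ^+ 2 - 4 * `|2^-1 *: (u + v)| ^+ 2.
Proof.
by rewrite normrZ exprMn ger0_norm ?invr_ge0// sqr_normB sqr_normD; field.
Qed.

Lemma cvg_dot (T : Type) (F : set_system T) (FF : Filter F) (f g : T -> H) u v :
  f @ F --> u -> g @ F --> v -> dot (f x) (g x) @[x --> F] --> dot u v.
Proof.
move=> fu gv; under eq_fun do rewrite dot_polar; rewrite dot_polar.
have cD : `|f x + g x| @[x --> F] --> `|u + v| by apply: cvg_norm; exact: cvgD.
have cB : `|f x - g x| @[x --> F] --> `|u - v| by apply: cvg_norm; exact: cvgB.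
have sqr (h : T -> R) (a : R) : h @ F --> a -> h x ^+ 2 @[x --> F] --> a ^+ 2.
  by move=> ha; rewrite expr2; under eq_fun do rewrite expr2; exact: cvgM.
by apply: cvgMr_tmp; apply: cvgB; exact: sqr.
Qed.

Lemma is_derive_sqr_norm (f : R -> H) (t : R) (df : H) : is_derive t 1 f df ->
  is_derive t 1 (fun s => `|f s| ^+ 2) (2 * dot (f t) df).
Proof.
move=> [dF dfE].
have ct : {for t, continuous f} by apply/differentiable_continuous/derivable1_diffP.
have lim_f : h^-1 *: (f (h *: 1 + t) - f t) @[h --> 0^'] --> df.
  by rewrite -dfE; exact: dF.
have lim_q : h^-1 *: (`|f (h *: 1 + t)| ^+ 2 - `|f t| ^+ 2) @[h --> 0^'] -->
    2 * dot (f t) df.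
  rewrite (_ : (fun h => _) = fun h =>
      dot (h^-1 *: (f (h *: 1 + t) - f t)) (f (h *: 1 + t) + f t)); last first.
    apply/funext => h; rewrite !dot_norm !dotE (dotC (f t) (f (h *: 1 + t))).
    by rewrite /GRing.scale/=; ring.
  rewrite (_ : 2 * _ = dot df (f t + f t)); last by rewrite dotDr dotC; ring.
  apply: cvg_dot => //; apply: cvgD; last exact: cvg_cst.
  have h0 : h *: (1 : R) + t @[h --> (0 : R)] --> t.
    have : continuous (fun h : R => h *: (1 : R) + t).
      by move=> h; apply: cvgD; [exact: scalel_continuous|exact: cvg_cst].
    by move=> /(_ 0); rewrite /continuous_at scale0r add0r.
  have fh : f (h *: (1 : R) + t) @[h --> (0 : R)] --> f t.
    by apply: (@cvg_comp _ _ _ (fun h : R => h *: (1 : R) + t) f _ _ _ h0); exact: ct.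
  have fh' : f (h *: (1 : R) + t) @[h --> (0 : R)^'] --> f t.
    by exact: cvg_within_filter fh.
  exact: fh'.
split; first by apply/cvg_ex; eexists; exact: lim_q.
exact/cvg_lim.
Qed.

End inner_product.

(** * Dini derivatives and barriers *)

Section real_line.
Context {R : realType}.

(** Induction on a segment: a property that holds at [a], that propagates a
    little to the right of any point where it holds, and that passes to limits
    from the left, holds at [b]. *)
Lemma real_induction (a b : R) (P : R -> Prop) : a <= b -> P a ->
  (forall t, a <= t -> t < b -> P t -> \forall s \near t^'+, P s) ->
  (forall t, a < t -> t <= b -> (forall s, a <= s -> s < t -> P s) -> P t) ->
  P b.
Proof.
move=> ab Pa Pr Pl.
pose S := [set t | a <= t <= b /\ forall s, a <= s -> s <= t -> P s].
have Sa : S a.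
  split; first by rewrite lexx.
  by move=> s as_ sa; have -> : s = a by apply/eqP; rewrite eq_le as_ sa.
have ubS : has_ubound S by exists b => t [/andP[]].
have supS : has_sup S by split; [exists a|].
pose c := sup S.
have ac : a <= c by exact: ub_le_sup.
have cb : c <= b by apply: sup_le_ub; [exists a|move=> t [/andP[]]].
have Pc' s : a <= s -> s < c -> P s.
  move=> as_ sc; have cs : 0 < c - s by rewrite subr_gt0.
  have [t [_ tP] st] := sup_adherent cs supS.
  by apply: tP => //; rewrite -/c in st; lra.
have Pc : P c.
  have := ac; rewrite le_eqVlt => /predU1P[<-//|ac'].
  exact: Pl.
have := cb; rewrite le_eqVlt => /predU1P[<-//|cb'].
have [e /= e0 eP] := Pr _ ac cb' Pc.
pose t := Num.min b (c + e / 2).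
have ct : c < t by rewrite /t lt_min cb' ltrDl divr_gt0.
suff St : S t by have := ub_le_sup ubS St; rewrite -/c leNgt ct.
split; first by rewrite (le_trans ac (ltW ct))/= /t ge_min lexx.
move=> s as_ st; have [sc|cs|->] := ltgtP s c; [exact: Pc'| |exact: Pc].
apply: eP => //=.
have : t <= c + e / 2 by rewrite /t ge_min lexx orbT.
by rewrite ltr0_norm ?subr_lt0//; lra.
Qed.

(** [dini_le p t g] says that the upper right Dini derivative of [p] at [t] is
    at most [g].  The bound is written without quotients. *)
Definition dini_le (p : R -> R) (t g : R) : Prop :=
  forall e : R, 0 < e -> \forall s \near t^'+, p s - p t <= (g + e) * (s - t).

(** A continuous function that starts below [c], and whose right Dini
    derivative is nonpositive wherever the function exceeds [c], stays below
    [c]. *)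
Lemma dini_barrier (p : R -> R) (a c : R) :
  (forall t, a <= t -> {for t, continuous p}) ->
  (forall t, a <= t -> c < p t -> dini_le p t 0) ->
  p a <= c -> forall t, a <= t -> p t <= c.
Proof.
move=> pc pD pa b ab.
apply/ler_addgt0Pr => e0 e0_gt0.
pose e := e0 / (1 + (b - a)).
have e_gt0 : 0 < e by rewrite divr_gt0//; lra.
suff : p b <= c + e * (1 + (b - a)).
  by rewrite /e divfK//; lra.
apply: (@real_induction a b (fun t => p t <= c + e * (1 + (t - a)))) => //.
- by rewrite subrr addr0 mulr1; lra.
- move=> t at_ tb; rewrite le_eqVlt => /predU1P[ptE|ptlt].
    have cpt : c < p t.
      by rewrite ptE ltrDl mulr_gt0//; lra.
    have := pD t at_ cpt e e_gt0.
    apply: filterS => s; rewrite add0r => hs.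
    by rewrite ptE in hs; nra.
  have : \forall s \near t^'+, p s < c + e * (1 + (t - a)).
    have pt : p s @[s --> t^'+] --> p t by apply: cvg_within_filter; exact: pc.
    exact: cvgr_lt pt _ ptlt.
  move=> h; near=> s.
  have ts : t < s by near: s; exact: nbhs_right_gt.
  have : p s < c + e * (1 + (t - a)) by near: s.
  by nra.
- move=> t at_ tb IH.
  have pt : p s @[s --> t^'-] --> p t.
    by apply: cvg_within_filter; apply: pc; exact: ltW.
  apply: (cvgr_to_le pt).
  near=> s.
  have st : s < t by near: s; exact: nbhs_left_lt.
  have as_ : a <= s by near: s; exact: nbhs_left_ge.
  by apply: le_trans (IH _ as_ st) _; nra.
Unshelve. all: by end_near. Qed.

End real_line.

(** * Mean value inequality for absolutely continuous functions *)

Section absolute_continuity.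
Context {R : realType} {V : normedModType R}.
Local Notation mu := (@lebesgue_measure R).

Lemma near_derivable (f : R -> V) (t e : R) : derivable f t 1 -> 0 < e ->
  \forall s \near t, `|f s - f t - (s - t) *: derive1 f t| <= e * `|s - t|.
Proof.
move=> df e0.
have dlim : h^-1 *: (f (h + t) - f t) @[h --> (0 : R)^'] --> derive1 f t.
  rewrite derive1E.
  have : h^-1 *: (f (h *: (1 : R) + t) - f t) @[h --> (0 : R)^'] --> 'D_1 f t := df.
  apply: cvg_trans; apply: near_eq_cvg; apply: nearW => h.
  by rewrite /GRing.scale/= mulr1.
have /cvgrPdist_le/(_ e e0) [d /= d0 dP] := dlim.
exists d => //= s /= sd.
have [->|st] := eqVneq s t; first by rewrite !subrr scale0r subr0 !normr0 mulr0.
have := dP (s - t); rewrite /ball_/= sub0r normrN distrC => /(_ sd).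
rewrite subr_eq0 => /(_ st); rewrite subrK => h.
have k0 : s - t != 0 by rewrite subr_eq0.
have ki : 0 < `|(s - t)^-1| by rewrite normr_gt0 invr_eq0.
rewrite -(ler_pM2l ki) -normrZ scalerBr scalerA mulVf// scale1r.
apply: (@le_trans _ _ e); first by rewrite -(distrC (derive1 f t)).
by rewrite (distrC t s) mulrCA -normrM mulVf// normr1 mulr1.
Qed.

Lemma increment_sym (f : R -> V) (c : V) (s t : R) :
  f t - f s - (t - s) *: c = - (f s - f t - (s - t) *: c).
Proof.
by rewrite 2!opprD 2!opprK (addrC (- f s)) -(opprB s t) scaleNr opprK.
Qed.

Lemma increment_chain (f : R -> V) (c : V) (a s t : R) :
  f t - f a - (t - a) *: c =
  (f t - f s - (t - s) *: c) + (f s - f a - (s - a) *: c).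
Proof.
rewrite addrACA -opprD -scalerDl; congr (_ - _ *: c); last by ring.
by rewrite addrA subrK.
Qed.

(** Local form of the mean value inequality: the function minus the linear map
    of slope [c] has increments from [t] of relative size at most [k + e]. *)
Lemma increment_near (f : R -> V) (c : V) (t k e : R) :
  derivable f t 1 -> `|derive1 f t - c| <= k -> 0 < e ->
  \forall s \near t, `|f s - f t - (s - t) *: c| <= (k + e) * `|s - t|.
Proof.
move=> df dfk e0; have := near_derivable df e0.
apply: filterS => s hs.
rewrite (_ : f s - f t - (s - t) *: c =
    (f s - f t - (s - t) *: derive1 f t) + (s - t) *: (derive1 f t - c)); last first.
  by rewrite scalerBr addrA subrK.
rewrite (le_trans (ler_normD _ _))// addrC mulrDl lerD// normrZ mulrC.
exact: ler_wpM2r.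
Qed.

(** The length of the part of [U] between [a] and [t] grows at unit speed as
    long as [t] runs through [U]. *)
Lemma lebesgue_measure_extend (U : set R) (a s t : R) : open U ->
  (mu U < +oo)%E -> s <= t -> (forall u, s <= u -> u <= t -> U u) -> a <= s ->
  fine (mu (U `&` `[a, s])) + (t - s) <= fine (mu (U `&` `[a, t])).
Proof.
move=> oU Ufin st sub as_.
have mU : measurable U by exact: measurable_realfun.open_measurable.
have fin (A : set R) : measurable A -> (mu (U `&` A) \is a fin_num).
  move=> mA; rewrite ge0_fin_numE//; apply: le_lt_trans Ufin.
  by apply: le_measure; rewrite ?inE//; exact: measurableI.
have mI (x y : R) : measurable `[x, y]%classic by exact: measurable_itv.
rewrite -lee_fin EFinD !fineK ?fin//.
have -> : ((t - s)%:E = mu `]s, t])%E.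
  by rewrite lebesgue_measure_itv/= lte_fin; case: ltgtP st => // -> _; rewrite subrr.
rewrite -measureU//.
- apply: le_measure; rewrite ?inE//; [|exact: measurableI|].
    by apply: measurableU => //; exact: measurableI.
  move=> u [[Uu]|]; rewrite /= !in_itv/= => /andP[h1 h2]; split => //.
  + by rewrite h1 (le_trans h2 st).
  + exact: sub (ltW h1) h2.
  + by rewrite h2 (le_trans as_ (ltW h1)).
- exact: measurableI.
- apply/seteqP; split => // u [[_]]; rewrite /= !in_itv/= => /andP[_ us] /andP[].
  by rewrite ltNge us.
Qed.

End absolute_continuity.

Section ac_mean_value.
Context {R : realType} {V : normedModType R}.
Local Notation mu := (@lebesgue_measure R).

(** Mean value inequality for absolutely continuous functions.  The exceptional
    null set is covered by an open set [U] of small measure.  Moving along the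
    segment, each small step either starts or ends at a point where the
    derivative exists, and then the increment is controlled by [k + e], or it
    lies inside [U].  The steps of the second kind are disjoint intervals of
    small total length, so their contribution is small by absolute
    continuity. *)
Lemma ac_mean_value (f : R -> V) (c : V) (a b k : R) : a <= b -> 0 <= k ->
  absolutely_continuous_on a b f ->
  {ae mu, forall t, a <= t -> t <= b -> derivable f t 1 /\ `|derive1 f t - c| <= k} ->
  `|f b - f a - (b - a) *: c| <= k * (b - a).
Proof.
move=> ab k0 acf [N [mN N0 subN]].
apply/ler_addgt0Pr => e0 e0_gt0.
pose e := e0 / (b - a + 2).
have ba : 0 <= b - a by rewrite subr_ge0.
have e_gt0 : 0 < e by rewrite divr_gt0//; lra.
suff : `|f b - f a - (b - a) *: c| <= (k + e) * (b - a) + 2 * e.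
  move=> /le_trans; apply; have : e0 = e * (b - a + 2) by rewrite divfK//; lra.
  by nra.
have [d d0 dP] := acf e e_gt0.
have c1 : 0 < `|c| + 1 by rewrite ltr_pwDr.
pose d' := Num.min d (e / (`|c| + 1)).
have d'0 : 0 < d' by rewrite lt_min d0 divr_gt0.
have Noo : (mu N < +oo)%E by rewrite [X in (X < _)%E]N0.
have [U [oU NU muU]] := lebesgue_regularity_outer mN Noo d'0.
have mU : measurable U by exact: measurable_realfun.open_measurable.
have Ud : (mu U < d'%:E)%E.
  apply: le_lt_trans muU; rewrite -[leRHS]adde0 -[X in (_ + X)%E]N0 -measureU//.
  - apply: le_measure; rewrite ?inE//.
      by apply: measurableU => //; exact: measurableD.
    by move=> u Uu; have [Nu|Nu] := pselect (N u); [right|left].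
  - exact: measurableD.
  - by apply/seteqP; split => // u [[_ ?]].
have Uoo : (mu U < +oo)%E by apply: lt_trans Ud _; rewrite ltry.
have good t : a <= t -> t <= b -> ~ U t ->
    derivable f t 1 /\ `|derive1 f t - c| <= k.
  move=> at_ tb nU; apply: contrapT => h; apply/nU/NU/subN => /= /(_ at_ tb).
  exact: h.
(* length of the part of the cover already met *)
pose m t := fine (mu (U `&` `[a, t])).
have m0 : 0 <= m a by rewrite fine_ge0.
have m_le s t : s <= t -> m s <= m t.
  move=> st; have mUI (u : R) : measurable (U `&` `[a, u]).
    by apply: measurableI => //; exact: measurable_itv.
  have fin (u : R) : mu (U `&` `[a, u]) \is a fin_num.
    rewrite ge0_fin_numE//; apply: le_lt_trans Uoo.
    by apply: le_measure; rewrite ?inE//; exact: mUI.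
  apply: fine_le => //; apply: le_measure; rewrite ?inE; [exact: mUI|exact: mUI|].
  move=> u [Uu]; rewrite /= !in_itv/= => /andP[au us]; split => //=.
  by rewrite au (le_trans us).
(* the two kinds of admissible steps *)
pose close s t := `|f t - f s - (t - s) *: c| <= (k + e) * (t - s) \/
                  forall u, s <= u -> u <= t -> U u.
have local t : a <= t -> t <= b ->
    \forall s \near t, (s <= t -> close s t) /\ (t <= s -> close t s).
  move=> at_ tb; have [Ut|nUt] := pselect (U t).
    have [r /= r0 rP] := open_nbhs_nbhs (conj oU Ut : open_nbhs t U).
    exists r => //= s /= sr; split => st; right => u su ut; apply: rP => /=.
      by move: sr; rewrite !ger0_norm ?subr_ge0//; lra.
    by move: sr; rewrite !ler0_norm ?subr_le0//; lra.
  have [df dfk] := good _ at_ tb nUt.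
  have := increment_near df dfk e_gt0.
  apply: filterS => s key; split => st; left.
    by rewrite increment_sym normrN -(opprB s t) -[in X in _ <= X]ler0_norm// subr_le0.
  by move: key; rewrite ger0_norm// subr_ge0.
(* [l i, r i] are the steps inside U made before t, ordered from left to right *)
pose P t := exists (n : nat) (l r : nat -> R),
  [/\ forall i, (i < n)%N -> [/\ a <= l i, l i <= r i & r i <= t],
      forall i j, (i < j)%N -> (j < n)%N -> r i <= l j,
      \sum_(i < n) (r i - l i) <= m t &
      `|f t - f a - (t - a) *: c| <= (k + e) * (t - a) +
         \sum_(i < n) (`|f (r i) - f (l i)| + `|c| * (r i - l i)) ].
have ext s t : a <= s -> s <= t -> t <= b -> close s t -> P s -> P t.
  move=> as_ st tb cst [n [l [r [lr dis len hf]]]].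
  have split_ft := increment_chain f c a s t.
  case: cst => [fst|Ust].
    exists n, l, r; split => //.
    - by move=> i /lr[? ? ris]; split => //; exact: le_trans st.
    - by rewrite (le_trans len)//; exact: m_le.
    - rewrite split_ft (le_trans (ler_normD _ _))//; lra.
  exists n.+1, (fun i => if i == n then s else l i),
    (fun i => if i == n then t else r i).
  have sum_ext (F : R -> R -> R) :
      \sum_(i < n.+1) F (if val i == n then s else l i) (if val i == n then t else r i)
      = \sum_(i < n) F (l i) (r i) + F s t.
    rewrite big_ord_recr/= eqxx; congr (_ + _); apply: eq_bigr => i _.
    by rewrite !(ltn_eqF (ltn_ord i)).
  split.
  - move=> i; rewrite ltnS leq_eqVlt => /predU1P[->|i_n]; first by rewrite eqxx.
    by rewrite ltn_eqF//; have [? ? ris] := lr _ i_n; split => //; exact: le_trans st.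
  - move=> i j ij; rewrite ltnS leq_eqVlt => /predU1P[jn|jn].
      by rewrite jn eqxx -jn ltn_eqF//; have [] := lr i (ltac:(by rewrite -jn)).
    by rewrite !ltn_eqF ?(ltn_trans ij)//; exact: dis.
  - rewrite (sum_ext (fun x y => y - x)).
    have := lebesgue_measure_extend oU Uoo st Ust as_; rewrite -/(m s) -/(m t); lra.
  - rewrite (sum_ext (fun x y => `|f y - f x| + `|c| * (y - x))) split_ft.
    have st0 : 0 <= t - s by rewrite subr_ge0.
    have h1 : `|f t - f s - (t - s) *: c| <= `|f t - f s| + `|c| * (t - s).
      by rewrite (le_trans (ler_normB _ _))// normrZ ger0_norm// mulrC.
    have h2 := ler_normD (f t - f s - (t - s) *: c) (f s - f a - (s - a) *: c).
    have h3 : 0 <= (k + e) * (t - s) by rewrite mulr_ge0//; lra.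
    lra.
have Pa : P a.
  exists 0%N, (fun=> 0), (fun=> 0); split => //; rewrite !big_ord0//.
  by rewrite !subrr scale0r subrr normr0 mulr0 addr0.
have [n [l [r [lr dis len hf]]]] : P b.
  apply: (real_induction ab Pa) => [t at_ tb Pt|t at_ tb IH].
    near=> s.
    have [_ h] : (s <= t -> close s t) /\ (t <= s -> close t s).
      by near: s; apply: cvg_within; exact: local (ltW tb).
    have ts : t <= s by near: s; exact: nbhs_right_ge.
    have sb : s <= b by near: s; exact: nbhs_right_le.
    exact: ext (h ts) Pt.
  have : \forall s \near t^'-, [/\ a <= s, s < t & close s t].
    near=> s; split.
    - by near: s; exact: nbhs_left_ge.
    - by near: s; exact: nbhs_left_lt.
    - have [h _] : (s <= t -> close s t) /\ (t <= s -> close t s).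
        by near: s; apply: cvg_within; exact: local (ltW at_) tb.
      by apply: h; near: s; exact: nbhs_left_le.
  move=> /filter_ex[s [as_ st cst]].
  exact: (ext s t) (ltW st) tb cst (IH _ as_ st).
apply: (le_trans hf); rewrite lerD2l big_split/= -mulr_sumr.
have len' : \sum_(i < n) (r i - l i) < d'.
  apply: (le_lt_trans len); rewrite -lte_fin fineK.
    apply: le_lt_trans Ud; apply: le_measure; rewrite ?inE//.
    by apply: measurableI => //; exact: measurable_itv.
  rewrite ge0_fin_numE//; apply: le_lt_trans Uoo.
  apply: le_measure; rewrite ?inE//.
  by apply: measurableI => //; exact: measurable_itv.
have h1 : \sum_(i < n) `|f (r i) - f (l i)| < e.
  apply: (dP n (fun i => l i) (fun i => r i)).
  - by move=> i; have [] := lr i (ltn_ord i).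
  - move=> i j _ _ [u []]; rewrite /= !in_itv/= => /andP[liu uri] /andP[lju urj].
    apply/val_inj; have [ij|ji|//] := ltngtP (val i) (val j).
      by have := dis _ _ ij (ltn_ord j); rewrite leNgt (lt_trans lju uri).
    by have := dis _ _ ji (ltn_ord i); rewrite leNgt (lt_trans liu urj).
  - by apply: lt_le_trans len' _; rewrite /d' ge_min lexx.
have h2 : `|c| * \sum_(i < n) (r i - l i) <= e.
  have : d' * (`|c| + 1) <= e by rewrite -ler_pdivlMr// /d' ge_min lexx orbT.
  have := normr_ge0 c; nra.
lra.
Unshelve. all: by end_near. Qed.

End ac_mean_value.

(** * Calculus of Dini derivatives *)

Section dini_calculus.
Context {R : realType}.
Implicit Types (p q G N : R -> R) (t g : R).

Lemma is_derive_dini q t g : is_derive t 1 q g -> dini_le q t g.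
Proof.
move=> [dq dqE] e e0; have := near_derivable dq e0.
move=> /cvg_within h; near=> s.
have ts : t < s by near: s; exact: nbhs_right_gt.
have : `|q s - q t - (s - t) * derive1 q t| <= e * `|s - t| by near: s; exact: h.
have st : 0 < s - t by rewrite subr_gt0.
rewrite derive1E dqE (gtr0_norm st) ler_norml => /andP[_ +].
by lra.
Unshelve. all: by end_near. Qed.

Lemma dini_le_trans p t g g' : dini_le p t g -> g <= g' -> dini_le p t g'.
Proof.
move=> pg gg' e e0; have h := pg e e0; near=> s.
have ts : t < s by near: s; exact: nbhs_right_gt.
have : p s - p t <= (g + e) * (s - t) by near: s; exact: h.
move=> /le_trans; apply; rewrite ler_pM2r ?subr_gt0//; lra.
Unshelve. all: by end_near. Qed.

(** Product and sum rule: a Dini bound on [q] gives one on [q G + N] when [G]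
    and [N] are differentiable and [G] is positive. *)
Lemma dini_leMD q G N t g dG dN : {for t, continuous q} -> dini_le q t g ->
  is_derive t 1 G dG -> 0 < G t -> is_derive t 1 N dN ->
  dini_le (fun s => q s * G s + N s) t (g * G t + q t * dG + dN).
Proof.
move=> cq qg dG' G0 dN' e e0.
have cG : {for t, continuous G}.
  by apply/differentiable_continuous/derivable1_diffP; case: dG'.
pose e1 := e / (4 * (G t + `|g| + `|q t| + 1)).
have Q0 : 0 < G t + `|g| + `|q t| + 1.
  by have := normr_ge0 g; have := normr_ge0 (q t); lra.
have e10 : 0 < e1 by rewrite divr_gt0//; lra.
have e1E : e = e1 * (4 * (G t + `|g| + `|q t| + 1)) by rewrite divfK//; lra.
have hq := qg e1 e10.
have /cvg_within hG : \forall s \near t, `|G s - G t - (s - t) * derive1 G t| <= e1 * `|s - t|.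
  by apply: near_derivable => //; case: dG'.
have /cvg_within hN : \forall s \near t, `|N s - N t - (s - t) * derive1 N t| <= e1 * `|s - t|.
  by apply: near_derivable => //; case: dN'.
have hc : \forall s \near t, `|G s - G t| < Num.min e1 (G t).
  by have /cvgrPdistC_lt := cG; apply; rewrite lt_min e10.
move/cvg_within in hc.
near=> s.
have ts : t < s by near: s; exact: nbhs_right_gt.
have st : 0 < s - t by rewrite subr_gt0.
have : q s - q t <= (g + e1) * (s - t) by near: s; exact: hq.
have : `|G s - G t - (s - t) * derive1 G t| <= e1 * `|s - t| by near: s; exact: hG.
have : `|N s - N t - (s - t) * derive1 N t| <= e1 * `|s - t| by near: s; exact: hN.
have : `|G s - G t| < Num.min e1 (G t) by near: s; exact: hc.
rewrite lt_min !ltr_norml => /andP[/andP[h1 h2] /andP[h3 h4]].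
rewrite !derive1E (gtr0_norm st).
rewrite (_ : 'D_1 N t = dN); last by case: dN'.
rewrite (_ : 'D_1 G t = dG); last by case: dG'.
rewrite !ler_norml => /andP[_ hNs] /andP[hGs1 hGs2] hqs.
have Gs0 : 0 < G s by lra.
have b1 : (q s - q t) * G s <= ((g + e1) * G s) * (s - t).
  by rewrite mulrAC ler_pM2r.
have b2 : (g + e1) * G s <= g * G t + `|g| * e1 + 2 * e1 * G t.
  have : g * (G s - G t) <= `|g| * e1.
    rewrite (le_trans (ler_norm _))// normrM ler_wpM2l//.
    by rewrite ler_norml; lra.
  nra.
have b3 : q t * (G s - G t) <= (q t * dG + `|q t| * e1) * (s - t).
  have : q t * (G s - G t - (s - t) * dG) <= `|q t| * (e1 * (s - t)).
    rewrite (le_trans (ler_norm _))// normrM ler_wpM2l//.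
    by rewrite ler_norml; lra.
  lra.
have b4 : ((g + e1) * G s) * (s - t) <=
    (g * G t + `|g| * e1 + 2 * e1 * G t) * (s - t) by rewrite ler_pM2r.
have b5 : (g * G t + `|g| * e1 + 2 * e1 * G t) * (s - t) +
    (q t * dG + `|q t| * e1) * (s - t) + (dN + e1) * (s - t)
    <= (g * G t + q t * dG + dN + e) * (s - t).
  rewrite -!mulrDl ler_pM2r// e1E.
  have := mulr_ge0 (ltW e10) (normr_ge0 g).
  have := mulr_ge0 (ltW e10) (normr_ge0 (q t)).
  have := mulr_gt0 e10 G0.
  lra.
lra.
Unshelve. all: by end_near. Qed.

End dini_calculus.

(** * Strict differentiability *)

Section calculus.
Context {R : realType} {V : normedModType R}.
Implicit Types (f : R -> V) (L c : V) (t a b k h : R).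

(** Differentiability expressed by a bound on increments, without quotients. *)
Lemma is_derive_near f t L :
  (forall e, 0 < e -> \forall s \near t, `|f s - f t - (s - t) *: L| <= e * `|s - t|) ->
  is_derive t 1 f L.
Proof.
move=> fL.
have lim : h^-1 *: (f (h *: (1 : R) + t) - f t) @[h --> (0 : R)^'] --> L.
  apply/cvgrPdist_le => e e0.
  have [d /= d0 dP] := fL e e0; exists d => //= h /=; rewrite sub0r normrN => hd h0.
  have := dP (h + t); rewrite /= opprD addrCA subrr addr0 normrN => /(_ hd).
  rewrite addrK [h%:A]mulr1 => bound.
  have -> : L - h^-1 *: (f (h + t) - f t) = - (h^-1 *: (f (h + t) - f t - h *: L)).
    by rewrite [in RHS]scalerBr scalerA mulVf// scale1r opprB.
  by rewrite normrN normrZ normfV ler_pdivrMl ?normr_gt0// mulrC.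
split; first by apply/cvg_ex; exists L; exact: lim.
exact/cvg_lim.
Qed.

Lemma near_is_derive f t e L : is_derive t 1 f L -> 0 < e ->
  \forall s \near t, `|f s - f t - (s - t) *: L| <= e * `|s - t|.
Proof.
move=> [df dfE] e0; have := near_derivable df e0; rewrite derive1E dfE.
exact.
Qed.

Lemma is_derive_translate f t h L : is_derive (t + h) 1 f L ->
  is_derive t 1 (fun s => f (s + h)) L.
Proof.
move=> df; apply: is_derive_near => e e0.
have [d /= d0 dP] := near_is_derive df e0; exists d => //= s /= sd.
have := dP (s + h); have -> : s + h - (t + h) = s - t by ring.
apply => /=; have -> // : t + h - (s + h) = t - s by ring.
Qed.

Lemma derivable_mean_value f (df : R -> V) c a b k : a <= b ->
  (forall t, a <= t -> t <= b -> is_derive t 1 f (df t) /\ `|df t - c| <= k) ->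
  `|f b - f a - (b - a) *: c| <= k * (b - a).
Proof.
move=> ab fdf; apply/ler_addgt0Pr => e0 e0_gt0.
pose e := e0 / (b - a + 1).
have ba : 0 <= b - a by rewrite subr_ge0.
have e_gt0 : 0 < e by rewrite divr_gt0//; lra.
suff : `|f b - f a - (b - a) *: c| <= (k + e) * (b - a).
  move=> /le_trans; apply; have : e0 = e * (b - a + 1) by rewrite divfK//; lra.
  by nra.
pose close s t := `|f t - f s - (t - s) *: c| <= (k + e) * (t - s).
have local t : a <= t -> t <= b ->
    \forall s \near t, (s <= t -> close s t) /\ (t <= s -> close t s).
  move=> at_ tb; have [ft dfk] := fdf _ at_ tb.
  case: ft => ft ftE; rewrite -ftE -derive1E in dfk.
  have := increment_near ft dfk e_gt0.
  apply: filterS => s key; split => st; rewrite /close; last first.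
    by move: key; rewrite ger0_norm// subr_ge0.
  by rewrite increment_sym normrN -(opprB s t) -[in X in _ <= X]ler0_norm// subr_le0.
have ext s t : close s t -> close a s -> close a t.
  move=> st as_; rewrite /close.
  rewrite (increment_chain f c a s t).
  by rewrite (le_trans (ler_normD _ _))//; move: st as_; rewrite /close; lra.
have Pa : close a a by rewrite /close !subrr scale0r subrr normr0 mulr0.
apply: (@real_induction _ a b (close a)) => // [t at_ tb Pt|t at_ tb IH].
  have /cvg_within loc := local t at_ (ltW tb).
  near=> s.
  have [_ h] : (s <= t -> close s t) /\ (t <= s -> close t s) by near: s; exact: loc.
  by apply: (ext t) => //; apply: h; near: s; exact: nbhs_right_ge.
have /cvg_within loc := local t (ltW at_) tb.
have : \forall s \near t^'-, [/\ a <= s, s < t & close s t].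
  near=> s; split.
  - by near: s; exact: nbhs_left_ge.
  - by near: s; exact: nbhs_left_lt.
  - have [h _] : (s <= t -> close s t) /\ (t <= s -> close t s) by near: s; exact: loc.
    by apply: h; near: s; exact: nbhs_left_le.
move=> /filter_ex[s [as_ st cst]].
by apply: (ext s t) => //; exact: IH.
Unshelve. all: by end_near. Qed.

(** Filter of the pairs (base point, step) tending to [(t, 0)], with the base
    point at or after [t] and the step positive. *)
Definition base_step t : set_system (R * R) :=
  within [set p | t <= p.1 /\ 0 < p.2] (nbhs (t, 0 : R)).

Lemma base_stepP t (P : R -> R -> Prop) :
  (exists2 d, 0 < d & forall s h, t <= s -> s < t + d -> 0 < h -> h < d -> P s h) <->
  \forall p \near base_step t, P p.1 p.2.
Proof.
split=> [[d d0 dP]|].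
  exists (ball t d, ball (0 : R) d) => /=; first by split; exact: nbhsx_ballx.
  move=> [s h]/= [/= std]; rewrite /ball/= sub0r normrN => hd [ts h0].
  apply: dP => //; first by move: std; rewrite /ball/= ler0_norm; lra.
  by rewrite -(gtr0_norm h0).
case=> -[A B] /= [[d1 /= d10 A1] [d2 /= d20 B2]] AB.
exists (Num.min d1 d2); first by rewrite lt_min d10.
move=> s h ts; rewrite -ltrBlDl lt_min => /andP[sd1 _] h0; rewrite lt_min => /andP[_ hd2].
apply: (AB (s, h)) => //; split => /=.
  by apply: A1 => /=; rewrite ler0_norm ?subr_le0// opprB.
by apply: B2 => /=; rewrite sub0r normrN gtr0_norm.
Qed.

#[global] Instance base_step_filter t : Filter (base_step t).
Proof. exact: within_filter. Qed.

(** A C^1 function is strictly differentiable: difference quotients converge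
    to the derivative even if the base point moves. *)
Lemma strict_derivative f (df : R -> V) t : (\forall s \near t, is_derive (s : R) 1 f (df s)) ->
  {for t, continuous df} ->
  p.2^-1 *: (f (p.1 + p.2) - f p.1) @[p --> base_step t] --> df t.
Proof.
move=> fdf /cvgrPdistC_le cdf; apply/cvgrPdistC_le => e e0.
have [d1 /= d10 fd] := fdf; have [d2 /= d20 cd] := cdf e e0.
apply/(base_stepP t (fun s h => `|h^-1 *: (f (s + h) - f s) - df t| <= e)).
exists (Num.min d1 d2 / 2); first by rewrite divr_gt0// lt_min d10.
move=> s h ts std h0 hd.
have close u : s <= u -> u <= s + h -> `|t - u| < Num.min d1 d2.
  by move=> su ush; rewrite ler0_norm; lra.
have : `|f (s + h) - f s - (s + h - s) *: df t| <= e * (s + h - s).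
  apply: (@derivable_mean_value f df); first by rewrite lerDl ltW.
  move=> u su ush; have := close u su ush; rewrite lt_min => /andP[ud1 ud2].
  by split; [exact: fd|exact: cd].
have -> : s + h - s = h by ring.
move=> bound.
have -> : h^-1 *: (f (s + h) - f s) - df t = h^-1 *: (f (s + h) - f s - h *: df t).
  by rewrite [in RHS]scalerBr scalerA mulVf ?gt_eqF// scale1r.
by rewrite normrZ normfV (gtr0_norm h0) ler_pdivrMl// mulrC.
Qed.

End calculus.

(** * Regularity of trajectories and the energy inequality *)

Section regularity.
Context {R : realType} {V : normedModType R}.
Local Notation mu := (@lebesgue_measure R).

Lemma ac_sub (a b a' b' : R) (f : R -> V) : a <= a' -> b' <= b ->
  absolutely_continuous_on a b f -> absolutely_continuous_on a' b' f.
Proof.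
move=> aa' bb' acf e e0; have [d d0 dP] := acf e e0.
exists d => // n l r lr; apply: dP => i; have [? [? ?]] := lr i.
by split; [exact: le_trans aa' _|split => //; exact: le_trans bb'].
Qed.

Lemma ac_continuous (a b t : R) (f : R -> V) : a < t -> t < b ->
  absolutely_continuous_on a b f -> {for t, continuous f}.
Proof.
move=> at_ tb acf; apply/cvgrPdist_lt => e e0; have [d d0 dP] := acf e e0.
have key u v : a <= u -> u <= v -> v <= b -> v - u < d -> `|f v - f u| < e.
  move=> au uv vb uvd.
  have := dP 1%N (fun=> u) (fun=> v); rewrite !big_ord1; apply => //.
  by move=> i j _ _ _; rewrite (ord1 i) (ord1 j).
near=> s.
have as_ : a < s by near: s; exact: lt_nbhsr.
have sb : s < b by near: s; exact: lt_nbhsl.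
have sd : `|t - s| < d by near: s; exists d.
have [st|ts] := leP s t.
  apply: (key s t (ltW as_) st (ltW tb)).
  by move: sd; rewrite ger0_norm ?subr_ge0.
rewrite distrC; apply: (key t s (ltW at_) (ltW ts) (ltW sb)).
by move: sd; rewrite ltr0_norm ?subr_lt0// opprB.
Unshelve. all: by end_near. Qed.

(** At interior points of the half-line, the derivative along the half-line is
    the usual derivative. *)
Lemma quotients_within_derive (t0 t : R) (f : R -> V) : t0 < t ->
  continuously_differentiable_on `[t0, +oo[ f ->
  is_derive t 1 f (derive_within `[t0, +oo[ f t).
Proof.
move=> tt [df _].
have tA : `[t0, +oo[%classic t by rewrite /= in_itv/= andbT ltW.
have lim : (fun s => (s - t)^-1 *: (f s - f t)) @ within `[t0, +oo[%classic t^' -->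
    derive_within `[t0, +oo[ f t := df t tA.
apply: is_derive_near => e e0.
have /cvgrPdistC_le/(_ e e0) := lim.
rewrite !near_withinE => h; near=> s.
have [->|st] := eqVneq s t; first by rewrite !subrr scale0r subr0 !normr0 mulr0.
have ts : t0 < s by near: s; exact: lt_nbhsr.
have : `|(s - t)^-1 *: (f s - f t) - derive_within `[t0, +oo[ f t| <= e.
  have : s != t -> `[t0, +oo[%classic s ->
      `|(s - t)^-1 *: (f s - f t) - derive_within `[t0, +oo[ f t| <= e.
    by near: s; exact: h.
  by apply => //; rewrite /= in_itv/= andbT ltW.
have st0 : s - t != 0 by rewrite subr_eq0.
have -> : (s - t)^-1 *: (f s - f t) - derive_within `[t0, +oo[ f t =
    (s - t)^-1 *: (f s - f t - (s - t) *: derive_within `[t0, +oo[ f t).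
  by rewrite [in RHS]scalerBr scalerA mulVf// scale1r.
by rewrite normrZ normfV ler_pdivrMl ?normr_gt0// mulrC.
Unshelve. all: by end_near. Qed.

Lemma derive_within_continuous (t0 t : R) (f : R -> V) : t0 < t ->
  continuously_differentiable_on `[t0, +oo[ f ->
  {for t, continuous (derive_within `[t0, +oo[ f)}.
Proof.
move=> tt [_ /continuous_within_itvcyP[h _]].
by apply: h; rewrite in_itv/= andbT.
Qed.

End regularity.

Lemma right_quotient {R : realType} {V : normedModType R} (f : R -> V) (t : R) (L : V) :
  is_derive t 1 f L -> h^-1 *: (f (t + h) - f t) @[h --> (0 : R)^'+] --> L.
Proof.
move=> df; apply/cvgrPdistC_le => e e0.
have [d /= d0 dP] := near_is_derive df e0.
near=> h.
have h0 : 0 < h by near: h; exact: nbhs_right_gt.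
have hd : h < d by near: h; exact: nbhs_right_lt.
have := dP (t + h); rewrite /= (_ : t - (t + h) = - h); last by ring.
rewrite (_ : t + h - t = h); last by ring.
rewrite normrN gtr0_norm// => /(_ hd) bound.
have -> : h^-1 *: (f (t + h) - f t) - L = h^-1 *: (f (t + h) - f t - h *: L).
  by rewrite [in RHS]scalerBr scalerA mulVf ?gt_eqF// scale1r.
by rewrite normrZ normfV (gtr0_norm h0) ler_pdivrMl// mulrC.
Unshelve. all: by end_near. Qed.

Section trajectory.
Context {R : realType} {H : completeNormedModType R}.
Variable dot : {dot H for idfun}.
Hypothesis dot_norm : norm_induced_by dot.
Variables (M : H -> H) (eps : R -> R) (t0 : R) (x0 : H) (x : R -> H).
Hypotheses (M_mono : monotone_op dot M) (M_cont : continuous M).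

(** The velocity prescribed by the equation at the point [x t].  It is defined
    for every [t], and continuous where [eps] and [x] are, whereas the equation
    only determines [derive1 x] almost everywhere. *)
Definition velocity (t : R) : H := - (M (x t) + eps t *: x t).

Lemma velocity_continuous (t : R) : {for t, continuous eps} ->
  {for t, continuous x} -> {for t, continuous velocity}.
Proof.
move=> ce cx.
have h1 : M (x s) @[s --> t] --> M (x t) by apply: (@cvg_comp _ _ _ x M _ _ _ cx); exact: M_cont.
have h2 : eps s *: x s @[s --> t] --> eps t *: x t by exact: cvgZ.
exact: cvgN (cvgD h1 h2).
Qed.

(** A strong solution satisfies the equation at every time after [t0]: by the
    mean value inequality, its increments near [t] are those of the linear map
    of slope [velocity t], up to the oscillation of the velocity. *)
Lemma strong_solution_is_derive (t : R) : strong_global_solution M eps t0 x0 x ->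
  t0 < t -> {for t, continuous eps} -> is_derive t 1 x (velocity t).
Proof.
move=> [acx _ odex _] tt ce.
have cx : {for t, continuous x}.
  by apply: (ac_continuous tt _ (acx (t + 1) _)); rewrite ?ltrDl//; lra.
apply: is_derive_near => e e0.
have /cvgrPdistC_le/(_ e e0) cv := velocity_continuous ce cx.
have [d /= d0 dP] := cv.
have key u v : t0 <= u -> u <= v -> (forall s, u <= s -> s <= v -> `|t - s| < d) ->
    `|x v - x u - (v - u) *: velocity t| <= e * (v - u).
  move=> tu uv close; apply: ac_mean_value => //; first exact: ltW.
    by apply: ac_sub (acx v (le_trans tu uv)).
  apply: (@filterS _ _ (ae_filter_ringOfSetsType (@lebesgue_measure R)) _ _ _ odex).
  move=> s odes us sv; have [dx ode] := odes (le_trans tu us).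
  split => //; have -> : derive1 x s = velocity s.
    by apply/eqP; rewrite -addr_eq0 addrA ode.
  exact: dP (close _ us sv).
near=> s.
have ts : t0 < s by near: s; exact: lt_nbhsr.
have sd : `|t - s| < d by near: s; exists d.
have [st|st] := leP s t.
  rewrite increment_sym normrN ler0_norm ?subr_le0// opprB.
  apply: key (ltW ts) st _ => u su ut.
  by move: sd; rewrite !ger0_norm ?subr_ge0//; [lra|exact: le_trans ut].
rewrite gtr0_norm ?subr_gt0//.
apply: key (ltW tt) (ltW st) _ => u su ut.
by move: sd; rewrite !ler0_norm; lra.
Unshelve. all: by end_near. Qed.

(** Energy inequality.  The derivative of the squared norm of the difference
    quotient [w s h] is at most [G s h] by monotonicity of [M], and [G] tends to
    the announced bound as [(s, h)] tends to [(t, 0)]. *)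
Lemma energy_dini (deps : R -> R) (t : R) :
  (\forall s \near t, is_derive (s : R) 1 eps (deps s)) -> {for t, continuous deps} ->
  (\forall s \near t, is_derive (s : R) 1 x (velocity s)) -> {for t, continuous velocity} ->
  dini_le (fun s => `|velocity s| ^+ 2) t
    (- 2 * eps t * `|velocity t| ^+ 2 - 2 * deps t * dot (x t) (velocity t)).
Proof.
move=> deps_is cdeps x_is cv e e0.
set g := (X in X + e).
pose w (s h : R) := h^-1 *: (x (s + h) - x s).
pose d (s h : R) := h^-1 *: (eps (s + h) - eps s).
pose G (s h : R) := - 2 * eps s * `|w s h| ^+ 2 - 2 * d s h * dot (x (s + h)) (w s h).
have deriv_cont (W : normedModType R) (f : R -> W) (df : R -> W) :
    (\forall s \near t, is_derive (s : R) 1 f (df s)) -> {for t, continuous f}.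
  by move=> /nbhs_singleton[dft _]; apply/differentiable_continuous/derivable1_diffP.
have limw : w p.1 p.2 @[p --> base_step t] --> velocity t.
  exact: strict_derivative.
have limd : d p.1 p.2 @[p --> base_step t] --> deps t.
  exact: strict_derivative.
have lim1 : p.1 @[p --> base_step t] --> t.
  apply: cvg_within_filter; exact: cvg_fst.
have lim12 : p.1 + p.2 @[p --> base_step t] --> t.
  rewrite -[X in _ --> X]addr0; apply: cvgD => //.
  apply: cvg_within_filter; exact: cvg_snd.
have limG : G p.1 p.2 @[p --> base_step t] --> g.
  have ce : eps p.1 @[p --> base_step t] --> eps t.
    by apply: (@cvg_comp _ _ _ _ eps _ _ _ lim1); exact: deriv_cont deps_is.
  have cx : x (p.1 + p.2) @[p --> base_step t] --> x t.
    by apply: (@cvg_comp _ _ _ _ x _ _ _ lim12); exact: deriv_cont x_is.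
  have cw2 : `|w p.1 p.2| ^+ 2 @[p --> base_step t] --> `|velocity t| ^+ 2.
    rewrite expr2; under eq_fun do rewrite expr2.
    by apply: cvgM; exact: cvg_norm.
  apply: cvgB; apply: cvgM.
  - by apply: cvgM => //; exact: cvg_cst.
  - exact: cw2.
  - by apply: cvgM => //; exact: cvg_cst.
  - exact: (cvg_dot dot_norm).
have /cvgr_lt/(_ (g + e)) := limG.
rewrite ltrDl => /(_ e0) /(base_stepP t (fun s h => G s h < g + e))[r r0 rP].
have [r1 /= r10 xP] := x_is.
near=> s.
have ts : t < s by near: s; exact: nbhs_right_gt.
have sr : s < t + r by near: s; apply: nbhs_right_lt; rewrite ltrDl.
have sr1 : s < t + r1 by near: s; apply: nbhs_right_lt; rewrite ltrDl.
have dx u : t <= u -> u < t + r1 -> is_derive u 1 x (velocity u).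
  by move=> tu ur; apply: xP => /=; rewrite ler0_norm; lra.
have incr h : 0 < h -> h < r -> s + h < t + r1 ->
    `|w s h| ^+ 2 - `|w t h| ^+ 2 <= (g + e) * (s - t).
  move=> h0 hr shr1.
  have dq u : t <= u -> u <= s -> is_derive u 1 (fun u => `|w u h| ^+ 2)
      (2 * dot (w u h) (h^-1 *: (velocity (u + h) - velocity u))).
    move=> tu us; apply: (is_derive_sqr_norm dot_norm).
    apply: is_deriveZ; apply: is_deriveB; last by apply: dx; lra.
    by apply: is_derive_translate; apply: dx; lra.
  have [u uts ->] : exists2 u, u \in `]t, s[ & `|w s h| ^+ 2 - `|w t h| ^+ 2 =
      (2 * dot (w u h) (h^-1 *: (velocity (u + h) - velocity u))) * (s - t).
    apply: (@MVT _ (fun u => `|w u h| ^+ 2)) => //.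
      by move=> u; rewrite in_itv/= => /andP[tu us]; apply: dq; exact: ltW.
    apply: derivable_within_continuous => u; rewrite in_itv/= => /andP[tu us].
    by have [] := dq u tu us.
  move: uts; rewrite in_itv/= => /andP[tu us].
  rewrite ler_pM2r ?subr_gt0//; apply: (@le_trans _ _ (G u h)); last first.
    by apply/ltW/rP => //; [exact: ltW|lra].
  have mono := M_mono (x (u + h)) (x u).
  have hw : x (u + h) - x u = h *: w u h by rewrite /w scalerA divff ?scale1r ?gt_eqF.
  have hd : eps (u + h) - eps u = h * d u h.
    by rewrite /d /GRing.scale/= mulrA divff ?mul1r ?gt_eqF.
  have dv : velocity (u + h) - velocity u = - (M (x (u + h)) - M (x u)) -
      ((eps u * h) *: w u h + (h * d u h) *: x (u + h)).
    rewrite -scalerA -hw -hd.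
    have -> : eps u *: (x (u + h) - x u) + (eps (u + h) - eps u) *: x (u + h) =
        eps (u + h) *: x (u + h) - eps u *: x u.
      by rewrite scalerBr scalerBl addrC addrA subrK.
    by rewrite /velocity !opprD !opprK addrACA.
  rewrite /G dv; rewrite hw in mono.
  move: (w u h) (d u h) (M (x (u + h)) - M (x u)) mono => W D E mono.
  rewrite dotZr pmulr_rge0// in mono.
  have : 0 <= h^-1 * dot E W by rewrite mulr_ge0// invr_ge0 ltW.
  rewrite dotZr dotDr !dotNr dotDr !dotZr -dot_norm !(dotC dot W) => mono'.
  have -> : 2 * (h^-1 * (- dot E W -
      (eps u * h * `|W| ^+ 2 + h * D * dot (x (u + h)) W))) =
      - 2 * (h^-1 * dot E W)
      - 2 * eps u * `|W| ^+ 2 - 2 * D * dot (x (u + h)) W.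
    by field; rewrite gt_eqF.
  lra.
have qlim u : t <= u -> u < t + r1 -> `|w u h| ^+ 2 @[h --> (0 : R)^'+] --> `|velocity u| ^+ 2.
  move=> tu ur; rewrite expr2; under eq_fun do rewrite expr2.
  by apply: cvgM; apply: cvg_norm; exact: (right_quotient (dx u tu ur)).
have lim : `|w s h| ^+ 2 - `|w t h| ^+ 2 @[h --> (0 : R)^'+] -->
    `|velocity s| ^+ 2 - `|velocity t| ^+ 2.
  by apply: cvgB; apply: qlim; lra.
apply: (cvgr_to_le lim); near=> h; apply: incr.
- by near: h; exact: nbhs_right_gt.
- by near: h; exact: nbhs_right_lt.
- rewrite -ltrBrDl; near: h; apply: nbhs_right_lt; lra.
Unshelve. all: by end_near. Qed.

End trajectory.

(** * Zeros of monotone operators *)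

Section convexity.
Context {R : realType} {H : completeNormedModType R}.
Variable dot : {dot H for idfun}.
Hypothesis dot_norm : norm_induced_by dot.

(** Bounded decreasing sequences of nonempty closed convex sets intersect.
    Points of almost least norm in the successive sets form a Cauchy sequence,
    by the parallelogram identity.  Only midpoint convexity is needed. *)
Lemma closed_convex_common_point (C : nat -> set H) (B : R) :
  (forall n, C n !=set0) -> (forall n, closed (C n)) ->
  (forall n u v, C n u -> C n v -> C n (2^-1 *: (u + v))) ->
  (forall n m, (n <= m)%N -> C m `<=` C n) ->
  (forall u, C 0%N u -> `|u| <= B) ->
  exists p, forall n, C n p.
Proof.
move=> C0 clC midC decC bndC.
(* D is the supremum of the distances of the sets C n to the origin *)
pose S := [set r : R | exists n, forall u, C n u -> r <= `|u|].
have S0 : S 0 by exists 0%N => u _.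
have ubS : ubound S B.
  move=> r [n rP]; have [u Cu] := C0 n.
  by rewrite (le_trans (rP u Cu))//; exact: bndC (decC _ _ (leq0n n) _ Cu).
have supS : has_sup S by split; [exists 0|exists B].
pose D := sup S.
have D0 : 0 <= D by apply: ub_le_sup => //; exists B.
have pick k : exists nu : nat * H, [/\ (k <= nu.1)%N, C nu.1 nu.2,
    `|nu.2| < D + k.+1%:R^-1 & forall v, C nu.1 v -> D - k.+1%:R^-1 <= `|v|].
  have k0 : 0 < k.+1%:R^-1 :> R by rewrite invr_gt0.
  have [r [n rP] Dr] := sup_adherent k0 supS.
  pose N := maxn n k.
  have /existsNP[u /not_implyP[Cu /negP]] : ~ (forall u, C N u -> D + k.+1%:R^-1 <= `|u|).
    move=> h; have /(ub_le_sup (ex_intro _ B ubS)) : S (D + k.+1%:R^-1) by exists N.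
    by rewrite -/D leNgt ltrDl k0.
  rewrite -ltNge => uD; exists (N, u); split => //=; first exact: leq_maxr.
  move=> v /(decC _ _ (leq_maxl n k)) /rP; apply: le_trans; exact: ltW.
have [f fP] := choice pick.
pose p k := (f k).2.
have close k l : (k <= l)%N -> `|p k - p l| ^+ 2 <= 16 * (D + 1) * k.+1%:R^-1.
  move=> kl; have [kn Cp pD vD] := fP k; have [ln Cp' pD' vD'] := fP l.
  have kl1 : l.+1%:R^-1 <= k.+1%:R^-1 :> R by rewrite lef_pV2 ?posrE// ler_nat.
  have k1 : k.+1%:R^-1 <= 1 :> R by rewrite invf_le1// ler1n.
  have k0 : 0 < k.+1%:R^-1 :> R by rewrite invr_gt0.
  set dk := k.+1%:R^-1 in pD vD kl1 k1 k0 *; set dl := l.+1%:R^-1 in pD' vD' kl1.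
  rewrite (parallelogram dot_norm) -/(p k) -/(p l) in pD pD' *.
  have mid : D - dk <= `|2^-1 *: (p k + p l)|.
    have [kln|lkn] := leqP (f k).1 (f l).1.
      by apply: vD; apply: midC => //; exact: decC kln _ Cp'.
    apply: (@le_trans _ _ (D - dl)); first by lra.
    by apply: vD'; apply: midC => //; exact: decC (ltnW lkn) _ Cp.
  have := normr_ge0 (p k); have := normr_ge0 (p l).
  move: mid pD pD'; set a := `|p k|; set b := `|p l|; set m := `|_| => mid pD pD' b0 a0.
  have m0 : 0 <= m by exact: normr_ge0.
  have a2 : a ^+ 2 <= (D + dk) ^+ 2 by rewrite ler_pXn2r ?nnegrE//; lra.
  have b2 : b ^+ 2 <= (D + dk) ^+ 2 by rewrite ler_pXn2r ?nnegrE//; lra.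
  have [Ddk|Ddk] := leP dk D.
    have m2 : (D - dk) ^+ 2 <= m ^+ 2 by rewrite ler_pXn2r ?nnegrE//; lra.
    nra.
  have : 0 <= m ^+ 2 by exact: sqr_ge0.
  nra.
have cvp : cvg (p @ \oo).
  apply: cauchy_cvg; apply: cauchy_exP => e e0.
  have : (fun n : nat => 16 * (D + 1) * n.+1%:R^-1) @ \oo --> 16 * (D + 1) * (0 : R).
    by apply: cvgMl_tmp; exact: cvg_harmonic.
  rewrite mulr0 => /cvgr_lt/(_ (e ^+ 2)); rewrite exprn_gt0// => /(_ isT)[k _ kP].
  exists (p k); exists k => // l /= kl.
  rewrite -ball_normE/= -(@ltr_pXn2r _ 2) ?nnegrE//; last exact: ltW.
  exact: le_lt_trans (close _ _ kl) (kP k (leqnn k)).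
exists (lim (p @ \oo)) => n.
apply: (closed_cvg (C n) (clC n) _ _ cvp).
exists n => // k /= nk; have [kn Cp _ _] := fP k.
exact: decC (leq_trans nk kn) _ Cp.
Qed.

Variable M : H -> H.
Hypotheses (M_mono : monotone_op dot M) (M_cont : continuous M).

(** Minty's argument: test the inequality at [p + s w] and let [s] tend to
    [0] from the right. *)
Lemma minty p : (forall y, 0 <= dot (M y) (y - p)) -> Zer M p.
Proof.
move=> Mp; rewrite /Zer/=.
have limM w : 0 <= dot (M p) w.
  have cp : p + s *: w @[s --> (0 : R)^'+] --> p.
    have : continuous (fun s : R => p + s *: w).
      by move=> s; apply: cvgD; [exact: cvg_cst|exact: scalel_continuous].
    move=> /(_ 0); rewrite /continuous_at scale0r addr0 => cp.
    exact: cvg_within_filter cp.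
  have cM : M (p + s *: w) @[s --> (0 : R)^'+] --> M p.
    by apply: (@cvg_comp _ _ _ (fun s : R => p + s *: w) M _ _ _ cp); exact: M_cont.
  have lim : dot (M (p + s *: w)) w @[s --> (0 : R)^'+] --> dot (M p) w.
    by apply: (cvg_dot dot_norm); [exact: cM|exact: cvg_cst].
  apply: (cvgr_to_ge lim); near=> s.
  have s0 : 0 < s by near: s; exact: nbhs_right_gt.
  by have := Mp (p + s *: w); rewrite addrAC subrr add0r dotZr pmulr_rge0.
have := limM (- M p); rewrite dotNr -dot_norm oppr_ge0 => h.
by apply/eqP; rewrite -normr_eq0 -sqrf_eq0 eq_le h sqr_ge0.
Unshelve. all: by end_near. Qed.

Lemma Zer_dot z y : Zer M z -> 0 <= dot (M y) (y - z).
Proof. by move=> Mz; have := M_mono y z; rewrite Mz subr0. Qed.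

Lemma Zer_convex u v (s : R) : Zer M u -> Zer M v -> 0 <= s -> s <= 1 ->
  Zer M (u + s *: (v - u)).
Proof.
move=> Mu Mv s0 s1; apply: minty => y.
have -> : y - (u + s *: (v - u)) = (1 - s) *: (y - u) + s *: (y - v).
  rewrite scalerBl scale1r -addrA [X in _ = _ + X]addrC -scalerBr (opprB y u).
  by rewrite [y - v + _]addrC addrA subrK opprD addrA -scalerN opprB.
by rewrite dotDr !dotZr addr_ge0// mulr_ge0 ?subr_ge0//; exact: Zer_dot.
Qed.

Lemma Zer_closed : closed (Zer M).
Proof.
apply: (@closed_comp _ _ M [set 0]) => [z _|]; first exact: M_cont.
exact/accessible_closed_set1/hausdorff_accessible/norm_hausdorff.
Qed.

(** The projection of the origin on the zeros of [M] is attained: it is the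
    common point of the sets of zeros of norm at most [r + 1 / (n + 1)], where
    [r] is the infimum of the norms of the zeros. *)
Lemma metric_proj_Zer : Zer M !=set0 ->
  Zer M (metric_proj (Zer M) 0) /\
  forall z, Zer M z -> `|metric_proj (Zer M) 0| <= `|z|.
Proof.
move=> [z0 Mz0].
suff [p [Mp pP]] : exists p, Zer M p /\ forall z, Zer M z -> `|0 - p| <= `|0 - z|.
  have [Mq qP] : [set p | Zer M p /\ forall z, Zer M z -> `|0 - p| <= `|0 - z|]
      (metric_proj (Zer M) 0) by apply: xgetPex; exists p.
  by split => // z /qP; rewrite !sub0r !normrN.
pose S := [set `|z| | z in Zer M].
have infS : has_inf S.
  by split; [exists `|z0|, z0|exists 0 => _ [z _ <-]].
pose r := inf S.
have rP z : Zer M z -> r <= `|z| by move=> Mz; apply: ge_inf; [case: infS|exists z].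
pose C n := Zer M `&` [set z | `|z| <= r + n.+1%:R^-1].
have [||||u [_ ?]|p pC] := @closed_convex_common_point C (r + 1%:R^-1).
- move=> n; have n0 : 0 < n.+1%:R^-1 :> R by rewrite invr_gt0.
  have [_ [z Mz <-] zr] := inf_adherent n0 infS.
  by exists z; split => //; exact: ltW.
- move=> n; apply: closedI; first exact: Zer_closed.
  apply: (@closed_comp _ _ (fun z : H => `|z|) [set s | s <= r + n.+1%:R^-1]).
    by move=> z _; exact: norm_continuous.
  exact: closed_le.
- move=> n u v [Mu un] [Mv vn]; split.
    have -> : 2^-1 *: (u + v) = u + 2^-1 *: (v - u).
      rewrite scalerDr scalerBr [RHS]addrCA [LHS]addrC; congr (_ + _).
      by rewrite -{2}(scale1r u) -scalerBl; congr (_ *: _); field.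
    by apply: Zer_convex => //; lra.
  rewrite /= normrZ ger0_norm ?invr_ge0//.
  have : `|u| + `|v| <= 2 * (r + n.+1%:R^-1) by rewrite mulr_natl mulr2n lerD.
  have := ler_normD u v; move: (n.+1%:R^-1) => k; lra.
- move=> n m nm u [Mu um]; split => //=; rewrite (le_trans um)// lerD2l.
  by rewrite lef_pV2 ?posrE// ler_nat.
- by [].
exists p; split; first by case: (pC 0%N).
move=> z /rP; rewrite !sub0r !normrN; apply: le_trans.
apply/ler_addgt0Pr => e e0.
have /cvgr_lt/(_ e e0)[k _ /(_ k (leqnn k))/= ke] := @cvg_harmonic R.
by have [_ /= pk] := pC k; rewrite (le_trans pk)// lerD2l ltW.
Qed.

(** Variational characterization of the zero of least norm. *)
Lemma min_norm_dot_ge0 p : Zer M p -> (forall z, Zer M z -> `|p| <= `|z|) ->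
  forall z, Zer M z -> 0 <= dot p (z - p).
Proof.
move=> Mp pmin z Mz; rewrite leNgt; apply/negP => neg.
pose a := - dot p (z - p); pose b := `|z - p| ^+ 2.
have a0 : 0 < a by rewrite oppr_gt0.
have b0 : 0 <= b by exact: sqr_ge0.
pose s := Num.min 1 (a / (b + 1)).
have s0 : 0 < s by rewrite lt_min ltr01 divr_gt0//; lra.
have s1 : s <= 1 by rewrite ge_min lexx.
have sb : s * (b + 1) <= a by rewrite -ler_pdivlMr ?ge_min ?lexx ?orbT//; lra.
have : `|p| ^+ 2 <= `|p + s *: (z - p)| ^+ 2.
  by rewrite ler_pXn2r ?nnegrE//; apply: pmin; apply: Zer_convex => //; exact: ltW.
rewrite (sqr_normD dot_norm) dotZr normrZ exprMn (ger0_norm (ltW s0)) -/b.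
rewrite -[dot p (z - p)]opprK -/a; nra.
Qed.

(** If the inner product with [p] is at least [<p, p>] on the zeros of [M], it
    is eventually almost so along any bounded curve on which [M] tends to [0].
    A common point of closed convex sets plays the part of a weak limit
    point. *)
Lemma near_dot_ge (x : R -> H) (t1 B : R) (p : H) :
  (forall t, t1 <= t -> `|x t| <= B) -> M (x t) @[t --> +oo] --> (0 : H) ->
  (forall z, Zer M z -> 0 <= dot p (z - p)) ->
  forall e, 0 < e -> \forall t \near +oo, - e <= dot p (x t - p).
Proof.
move=> xB Mx pP e e0; apply: contrapT => nnear.
have freq k : exists t, [/\ t1 <= t, `|M (x t)| <= k.+1%:R^-1 & dot p (x t - p) <= - e].
  apply: contrapT => h; apply: nnear.
  have k0 : 0 < k.+1%:R^-1 :> R by rewrite invr_gt0.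
  have /cvgrPdist_le/(_ _ k0) Mk := Mx.
  near=> t; rewrite leNgt; apply/negP => te; apply: h; exists t; split.
  - by near: t; apply: nbhs_pinfty_ge; rewrite num_real.
  - by rewrite -normrN -sub0r; near: t; exact: Mk.
  - exact: ltW.
have B0 : 0 <= B by have [t [tt _ _]] := freq 0%N; exact: le_trans (xB t tt).
(* closed convex sets containing x t for some large t; their common points
   satisfy Minty's inequality *)
pose C n := [set c : H | `|c| <= B] `&` [set c | dot p c <= dot p p - e] `&`
  \bigcap_y [set c | - (n.+1%:R^-1 * (`|y| + B)) <= dot (M y) y - dot (M y) c].
have dot_cont (u : H) : continuous (fun c : H => dot u c).
  by move=> c; apply: (cvg_dot dot_norm); [exact: cvg_cst|exact: cvg_id].
have [||||u [[? _] _]|q qC] := @closed_convex_common_point C B.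
- move=> n; have [t [tt Mt pt]] := freq n; exists (x t); split; first split => /=.
  + exact: xB.
  + by move: pt; rewrite dotDr dotNr; lra.
  move=> y _ /=; have := M_mono y (x t).
  rewrite dotDl dotNl !dotDr !dotNr.
  have := dot_ge dot_norm (M (x t)) (y - x t); rewrite dotDr dotNr.
  have : `|M (x t)| * `|y - x t| <= n.+1%:R^-1 * (`|y| + B).
    apply: ler_pM => //; rewrite (le_trans (ler_normB _ _))// lerD2l.
    exact: xB.
  move: (_ * (`|y| + B)) => k; lra.
- move=> n; apply: closedI; first apply: closedI.
  + apply: (@closed_comp _ _ (fun z : H => `|z|) [set s | s <= B]); last exact: closed_le.
    by move=> z _; exact: norm_continuous.
  + apply: (@closed_comp _ _ (fun z : H => dot p z) [set s | s <= dot p p - e]);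
      last exact: closed_le.
    by move=> z _; exact: dot_cont.
  + apply: closed_bigI => y _.
    apply: (@closed_comp _ _ (fun z : H => dot (M y) y - dot (M y) z)
      [set s | - (n.+1%:R^-1 * (`|y| + B)) <= s]); last exact: closed_ge.
    by move=> z _; apply: cvgB; [exact: cvg_cst|exact: dot_cont].
- move=> n u v [[/= uB pu] uM] [[/= vB pv] vM]; split; first split => /=.
  + rewrite normrZ ger0_norm ?invr_ge0//.
    by have := ler_normD u v; lra.
  + by rewrite dotZr dotDr; lra.
  + move=> y _ /=; have /= := uM y I; have /= := vM y I.
    by rewrite dotZr dotDr; move: (_ * (`|y| + B)) => k; lra.
- move=> n m nm u [? uM]; split => // y _ /=; have /= := uM y I.
  apply: le_trans; rewrite lerN2 ler_wpM2r ?addr_ge0//.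
  by rewrite lef_pV2 ?posrE// ler_nat.
- by [].
have Mq : Zer M q.
  apply: minty => y; rewrite dotDr dotNr.
  have lim : - (k.+1%:R^-1 * (`|y| + B)) @[k --> \oo] --> - ((0 : R) * (`|y| + B)).
    by apply: cvgN; apply: cvgMr_tmp; exact: cvg_harmonic.
  rewrite mul0r oppr0 in lim.
  apply: (cvgr_to_le lim); apply: nearW => k.
  by have [_ /(_ y I)] := qC k.
have := pP q Mq; have [[_ /= pq] _] := qC 0%N.
by rewrite dotDr dotNr; lra.
Unshelve. all: by end_near. Qed.

End convexity.

(** * The integrating factor *)

Section integrating_factor.
Context {R : realType}.
Variables (eps : R -> R) (t0 : R).
Local Notation mu := (@lebesgue_measure R).
Hypothesis eps_C1 : continuously_differentiable_on `[t0, +oo[ eps.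

(** At [t0] only the difference quotients from the right converge, which gives
    continuity from the right. *)
Lemma C1_within_continuous : {within `[t0, +oo[, continuous eps}.
Proof.
apply/continuous_within_itvcyP; split.
  move=> t; rewrite in_itv/= andbT => tt.
  have [dt _] := quotients_within_derive tt eps_C1.
  exact/differentiable_continuous/derivable1_diffP.
have [df _] := eps_C1.
have tA : `[t0, +oo[%classic t0 by rewrite /= in_itv/= lexx.
set L := derive_within `[t0, +oo[ eps t0.
have lim : (fun s => (s - t0)^-1 *: (eps s - eps t0)) @ within `[t0, +oo[%classic t0^' --> L
  := df t0 tA.
have /cvgrPdistC_le/(_ 1 ltr01) := lim.
rewrite !near_withinE => h.
have h' : \forall s \near t0^'+, s != t0 -> `[t0, +oo[%classic s ->
    `|(s - t0)^-1 *: (eps s - eps t0) - L| <= 1 by exact: cvg_within h.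
apply/cvgrPdistC_le => e e0.
near=> s.
have ts : t0 < s by near: s; exact: nbhs_right_gt.
have st : 0 < s - t0 by rewrite subr_gt0.
have : `|(s - t0)^-1 * (eps s - eps t0) - L| <= 1.
  have h's : s != t0 -> `[t0, +oo[%classic s ->
    `|(s - t0)^-1 *: (eps s - eps t0) - L| <= 1 by near: s; exact: h'.
  by apply: h's; [rewrite gt_eqF|rewrite /= in_itv/= andbT ltW].
set Q := (X in `|X - L|) => hQ.
have Qb : `|Q| <= `|L| + 1.
  by have := ler_normD (Q - L) L; rewrite subrK; lra.
have -> : eps s - eps t0 = (s - t0) * Q by rewrite /Q mulrA divff ?mul1r ?gt_eqF.
rewrite normrM (gtr0_norm st).
have sd : s - t0 < e / (`|L| + 1) by near: s; apply: nbhs_right_ltDr; rewrite divr_gt0// ltr_pwDr.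
have L1 : 0 < `|L| + 1 by rewrite ltr_pwDr.
move: sd; rewrite ltr_pdivlMr// => sd.
have : (s - t0) * `|Q| <= (s - t0) * (`|L| + 1) by rewrite ler_pM2l.
lra.
Unshelve. all: by end_near. Qed.

Lemma gamma_gt0 t : 0 < gamma_eps eps t0 t.
Proof. exact: expR_gt0. Qed.

Lemma C1_integrable t : mu.-integrable `[t0, t] (EFin \o eps).
Proof.
apply: continuous_compact_integrable; first exact: segment_compact.
apply: continuous_subspaceW C1_within_continuous.
by move=> s /=; rewrite !in_itv/= => /andP[-> _].
Qed.

Lemma is_derive_gamma t : t0 < t ->
  is_derive t 1 (gamma_eps eps t0) (eps t * gamma_eps eps t0 t).
Proof.
move=> tt.
have ce : {for t, continuous eps}.
  have [dt _] := quotients_within_derive tt eps_C1.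
  exact/differentiable_continuous/derivable1_diffP.
have tt1 : t < t + 1 by rewrite ltrDl.
pose G s := (\int[mu]_(u in `[t0, s]) eps u)%R.
have [dG] := continuous_FTC1_closed tt1 (C1_integrable _) tt ce.
rewrite derive1E -/G => GE.
have dG' : is_derive t 1 G (eps t) := DeriveDef dG GE.
rewrite mulrC.
exact: (@is_derive1_comp _ expR G t _ _ (is_derive_expR _) dG').
Qed.

Hypothesis eps_gt0 : forall t, t0 <= t -> 0 < eps t.
Hypothesis eps_int : (\int[mu]_(t in `[t0, +oo[) (eps t)%:E = +oo)%E.

(** Monotone convergence along the segments from [t0] to [t0 + n], together
    with [1 + s <= exp s]. *)
Lemma gamma_cvgy : gamma_eps eps t0 t @[t --> +oo] --> +oo.
Proof.
pose F (n : nat) := `[t0, t0 + n%:R]%classic.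
have lim : ((\int[mu]_(t in F n) (eps t)%:E) @[n --> \oo] --> +oo)%E.
  suff : ((\int[mu]_(t in F n) (eps t)%:E) @[n --> \oo] -->
      \int[mu]_(t in \bigcup_n F n) (eps t)%:E)%E.
    by rewrite -itv_bndy_bigcup_BRight eps_int.
  apply: ge0_nondecreasing_set_cvg_integral => //.
  - move=> n m nm; rewrite subsetEset => s; rewrite /F/= !in_itv/= => /andP[-> sn].
    by rewrite (le_trans sn)// lerD2l ler_nat.
  - by move=> n; exact: measurable_itv.
  - move=> n; have /integrableP[mf _] := C1_integrable (t0 + n%:R).
    exact: mf.
  - by move=> n s; rewrite /F/= in_itv/= => /andP[ts _]; rewrite lee_fin ltW// eps_gt0.
apply/cvgryPge => A.
have /cvgeyPge/(_ A)[n _ /(_ n (leqnn n))/= An] := lim.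
near=> t.
have nt : t0 + n%:R <= t by near: t; apply: nbhs_pinfty_ge; rewrite num_real.
apply: le_trans (expR_ge1Dx _).
apply: (@le_trans _ _ (\int[mu]_(u in `[t0, t]) eps u)%R); last by rewrite lerDr.
rewrite -lee_fin /Rintegral fineK; last exact: integrable_fin_num (C1_integrable t).
apply: (le_trans An); apply: ge0_subset_integral => //.
- exact: measurable_itv.
- by have /integrableP[mf _] := C1_integrable t.
- by move=> s /=; rewrite in_itv/= => /andP[ts _]; rewrite lee_fin ltW// eps_gt0.
- by move=> s; rewrite /F/= !in_itv/= => /andP[-> /le_trans->].
Unshelve. all: by end_near. Qed.

End integrating_factor.

(** * Asymptotics of trajectories *)

Section asymptotics.
Context {R : realType} {H : completeNormedModType R}.
Variable dot : {dot H for idfun}.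
Hypothesis dot_norm : norm_induced_by dot.
Variables (M : H -> H) (x : R -> H) (eps deps g : R -> R) (a : R).
Hypotheses (M_mono : monotone_op dot M) (M_cont : continuous M).
Local Notation v := (velocity M eps x).
Hypothesis x_is : forall t, a < t -> is_derive t 1 x (v t).
Hypothesis eps_is : forall t, a < t -> is_derive t 1 eps (deps t).
Hypothesis deps_cont : forall t, a < t -> {for t, continuous deps}.
Hypothesis eps_gt0 : forall t, a < t -> 0 < eps t.
Hypothesis g_is : forall t, a < t -> is_derive t 1 g (eps t * g t).
Hypothesis g_gt0 : forall t, 0 < g t.

Lemma is_derive_continuous (V : normedModType R) (f : R -> V) (t : R) (L : V) :
  is_derive t 1 f L -> {for t, continuous f}.
Proof. by case=> df _; exact/differentiable_continuous/derivable1_diffP. Qed.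

Lemma derive_le0_le (f df : R -> R) (b : R) :
  (forall t, b <= t -> is_derive t 1 f (df t) /\ df t <= 0) ->
  forall t, b <= t -> f t <= f b.
Proof.
move=> fdf; apply: dini_barrier => // t bt; first exact: is_derive_continuous (fdf t bt).1.
by move=> _; have [ft ft0] := fdf t bt; exact: dini_le_trans (is_derive_dini ft) ft0.
Qed.

Lemma velocity_dini (t : R) : a < t ->
  {for t, continuous (fun s => `|v s| ^+ 2)} /\
  dini_le (fun s => `|v s| ^+ 2) t
    (- 2 * eps t * `|v t| ^+ 2 - 2 * deps t * dot (x t) (v t)).
Proof.
move=> at_.
have cv : {for t, continuous v}.
  apply: velocity_continuous => //.
  - exact: is_derive_continuous (eps_is at_).
  - exact: is_derive_continuous (x_is at_).
split.
  have h : `|v s| @[s --> t] --> `|v t| by exact: cvg_norm cv.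
  exact: (cvgM h h).
apply: energy_dini => //.
- by near=> s; apply: eps_is; near: s; exact: lt_nbhsr.
- exact: deps_cont.
- by near=> s; apply: x_is; near: s; exact: lt_nbhsr.
Unshelve. all: by end_near. Qed.

Lemma is_derive_dist (p : H) (t : R) : a < t ->
  is_derive t 1 (fun s => `|x s - p| ^+ 2) (2 * dot (x t - p) (v t)).
Proof.
move=> at_; apply: (is_derive_sqr_norm dot_norm).
have := is_deriveB (x_is at_) (is_derive_cst p t 1).
by rewrite subr0.
Qed.

Lemma dot_dist_velocity (p : H) (t : R) : a < t -> Zer M p ->
  dot (x t - p) (v t) <= - eps t * (`|x t - p| ^+ 2 + dot p (x t - p)).
Proof.
move=> at_ Mp; rewrite /velocity dotNr dotDr dotZr.
have : 0 <= dot (x t - p) (M (x t)).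
  by rewrite dotC; exact: Zer_dot.
have -> : dot (x t - p) (x t) = `|x t - p| ^+ 2 + dot p (x t - p).
  by rewrite dot_norm -dotDl subrK dotC.
lra.
Qed.

(** Any zero [p] gives a bound: the distance to [p] does not increase as
    long as it exceeds [|p|]. *)
Lemma trajectory_bounded (b : R) : a < b -> Zer M !=set0 ->
  exists2 B, 0 < B & forall t, b <= t -> `|x t| <= B.
Proof.
move=> ab [p Mp].
pose c := Num.max `|x b - p| `|p|.
have c0 : 0 <= c by rewrite le_max normr_ge0.
have pc : `|p| <= c by rewrite le_max lexx orbT.
have bnd t : b <= t -> `|x t - p| ^+ 2 <= c ^+ 2.
  move=> bt; apply: (dini_barrier (p := fun s => `|x s - p| ^+ 2)) bt => [s bs|s bs cs|].
  - exact: is_derive_continuous (is_derive_dist p (lt_le_trans ab bs)).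
  - have as_ := lt_le_trans ab bs.
    apply: dini_le_trans (is_derive_dini (is_derive_dist p as_)) _.
    have := dot_dist_velocity as_ Mp.
    have e0 := eps_gt0 as_.
    have cs' : c < `|x s - p| by rewrite -(@ltr_pXn2r _ 2) ?nnegrE.
    have := dot_ge dot_norm p (x s - p).
    have : `|p| * `|x s - p| <= `|x s - p| * `|x s - p|.
      by rewrite ler_wpM2r// (le_trans pc)// ltW.
    rewrite expr2; move: (dot p _) => d; nra.
  - by rewrite ler_pXn2r ?nnegrE// le_max lexx.
exists (c + `|p| + 1); first by rewrite ltr_wpDl// addr_ge0.
move=> t bt; have := bnd t bt; rewrite ler_pXn2r ?nnegrE// => h.
by have := ler_normD (x t - p) p; rewrite subrK; lra.
Qed.

(** Comparison principle: a positive supersolution [W] of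
    [W' + eps W = B |eps'|] that dominates [|v|] at [b] dominates it
    afterwards.  The barrier argument is applied to [|v|^2 / W^2], at level
    [1]. *)
Lemma velocity_le (W dW : R -> R) (b B : R) : a < b ->
  (forall t, b <= t -> `|x t| <= B) ->
  (forall t, b <= t -> [/\ is_derive t 1 W (dW t), 0 < W t &
     B * `|deps t| <= dW t + eps t * W t]) ->
  `|v b| <= W b -> forall t, b <= t -> `|v t| <= W t.
Proof.
move=> ab xB WP vb t bt.
have dV2 s : b <= s -> is_derive s 1 (fun u => (W u ^+ 2)^-1) (- 2 * dW s / W s ^+ 3).
  move=> bs; have [dWs W0 _] := WP s bs.
  have Wn0 : W s != 0 by rewrite gt_eqF.
  have W2 : is_derive s 1 (fun u => W u ^+ 2) (2 * W s * dW s).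
    have := is_deriveM dWs dWs; rewrite (_ : W * W = fun u => W u ^+ 2); last first.
      by apply/funext => u; rewrite expr2.
    by move=> /is_derive_eq; apply; rewrite /GRing.scale/=; ring.
  have := is_deriveV _ W2; rewrite expf_eq0/= => /(_ Wn0).
  move=> /is_derive_eq; apply; rewrite /GRing.scale/=; by field.
have : `|v t| ^+ 2 * (W t ^+ 2)^-1 + 0 <= 1.
  apply: (dini_barrier (p := fun s => `|v s| ^+ 2 * (W s ^+ 2)^-1 + 0)) bt => [s bs|s bs ps|].
  - have [cq _] := velocity_dini (lt_le_trans ab bs).
    apply: cvgD; last exact: cvg_cst.
    by apply: cvgM => //; exact: is_derive_continuous (dV2 s bs).
  - have as_ := lt_le_trans ab bs.
    have [cq dq] := velocity_dini as_.
    have [dWs W0 Wineq] := WP s bs.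
    have W20 : 0 < (W s ^+ 2)^-1 by rewrite invr_gt0 exprn_gt0.
    apply: dini_le_trans (dini_leMD cq dq (dV2 s bs) W20 (is_derive_cst 0 s 1)) _.
    rewrite addr0.
    have qW : W s < `|v s|.
      move: ps; rewrite addr0 -ltr_pdivrMr ?invr_gt0 ?exprn_gt0// mul1r invrK.
      by rewrite ltr_pXn2r ?nnegrE// ltW.
    have B0 : 0 <= B by exact: le_trans (xB s bs).
    have dv : - deps s * dot (x s) (v s) <= B * `|deps s| * `|v s|.
      rewrite (le_trans (ler_norm _))// normrM normrN (mulrC B) -mulrA ler_wpM2l//.
      rewrite ler_norml (le_trans _ (dot_ge dot_norm _ _)) ?(le_trans (dot_le dot_norm _ _))//.
        by rewrite ler_wpM2r// xB.
      by rewrite lerN2 ler_wpM2r// xB.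
    rewrite -(pmulr_rle0 _ (_ : 0 < W s ^+ 3 / 2)); last by rewrite divr_gt0// exprn_gt0.
    (* multiply the bound by W^3 / 2 to clear denominators *)
    have -> : W s ^+ 3 / 2 * ((- 2 * eps s * `|v s| ^+ 2 - 2 * deps s * dot (x s) (v s)) *
       (W s ^+ 2)^-1 + `|v s| ^+ 2 * (- 2 * dW s / W s ^+ 3)) =
       (- eps s * `|v s| ^+ 2 + (- deps s * dot (x s) (v s))) * W s - `|v s| ^+ 2 * dW s.
      by field; rewrite gt_eqF.
    have K0 : 0 <= B * `|deps s| by rewrite mulr_ge0.
    move: dv Wineq qW W0 K0.
    move: (B * `|deps s|) (eps s) (- deps s * _) (dW s) (W s) => K e D w W1.
    have := normr_ge0 (v s); move: `|v s| => n n0 h1 h2 h3 h4 K0.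
    have : D * W1 <= K * n * W1 by rewrite ler_pM2r.
    have : n ^+ 2 * (K - e * W1) <= n ^+ 2 * w by rewrite ler_wpM2l ?sqr_ge0//; lra.
    have : 0 <= K * n * (n - W1) by rewrite !mulr_ge0//; lra.
    lra.
  - rewrite addr0 ler_pdivrMr ?mul1r ?exprn_gt0//; last by have [] := WP b (lexx b).
    by rewrite ler_pXn2r ?nnegrE//; have [_ /ltW] := WP b (lexx b).
have [_ W0 _] := WP t bt.
rewrite addr0 ler_pdivrMr ?mul1r ?exprn_gt0// ler_pXn2r ?nnegrE//.
exact: ltW.
Qed.

(** When [eps' <= - eps^2], the product [eps g] is nonincreasing. *)
Lemma eps_gamma_le (b t : R) : a < b ->
  (forall s, b <= s -> deps s <= - eps s ^+ 2) -> b <= t ->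
  eps t * g t <= eps b * g b.
Proof.
move=> ab deps_le; apply: (derive_le0_le (f := fun s => eps s * g s)
  (df := fun s => eps s *: (eps s * g s) + g s *: deps s)) => s bs; split.
  have as_ := lt_le_trans ab bs; exact: is_deriveM (eps_is as_) (g_is as_).
have -> : eps s *: (eps s * g s) + g s *: deps s = (deps s + eps s ^+ 2) * g s.
  by rewrite /GRing.scale/=; ring.
by rewrite pmulr_lle0//; have := deps_le s bs; lra.
Qed.

(** Case [eps_i > 1]; the supersolution is [A / g - D eps]. *)
Lemma velocity_le_fast (b B c : R) : a < b -> 1 < c -> 0 < B ->
  (forall t, b <= t -> `|x t| <= B) ->
  (forall t, b <= t -> deps t <= - c * eps t ^+ 2) ->
  exists C, forall t, b <= t -> `|v t| <= C / g t.
Proof.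
move=> ab c1 B0 xB deps_le.
have deps_le1 s : b <= s -> deps s <= - eps s ^+ 2.
  by move=> bs; have := deps_le s bs; have := sqr_ge0 (eps s); nra.
(* D is the constant for which - D (eps' + eps^2) >= B |eps'|; A makes W
   positive and larger than |v| at b *)
pose D := B * c / (c - 1).
have D0 : 0 <= D by rewrite divr_ge0 ?mulr_ge0//; lra.
have DE : D * (c - 1) = B * c by rewrite /D divfK// gt_eqF// subr_gt0.
pose A := (`|v b| + D * eps b + 1) * g b.
exists A => t bt.
apply: (@le_trans _ _ (A * (g t)^-1 - D * eps t)); last first.
  by rewrite gerBl mulr_ge0// ltW// eps_gt0// (lt_le_trans ab bt).
apply: (velocity_le (W := fun s => A * (g s)^-1 - D * eps s)
  (dW := fun s => - (A * eps s / g s) - D * deps s) ab xB) bt => [s bs|]; last first.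
  rewrite /A mulfK ?gt_eqF//; lra.
have as_ := lt_le_trans ab bs.
have gs0 := g_gt0 s.
split.
- have dgV : is_derive s 1 (fun u => (g u)^-1) (- (g s) ^- 2 *: (eps s * g s)).
    by apply: is_deriveV; [rewrite gt_eqF|exact: g_is].
  have := is_deriveB (is_deriveZ A dgV) (is_deriveZ D (eps_is as_)).
  by move=> /is_derive_eq; apply; rewrite /GRing.scale/=; field; rewrite gt_eqF.
- have := eps_gamma_le ab deps_le1 bs; have := eps_gt0 as_ => e0 h.
  rewrite -(pmulr_lgt0 _ gs0) mulrBl divfK ?gt_eqF//.
  have : D * (eps s * g s) <= D * (eps b * g b) by rewrite ler_wpM2l.
  have : 0 <= `|v b| * g b by rewrite mulr_ge0// ltW.
  by have := g_gt0 b; rewrite /A; lra.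
- have e0 := eps_gt0 as_.
  have e2 : 0 < eps s ^+ 2 by rewrite exprn_gt0.
  have -> : - (A * eps s / g s) - D * deps s + eps s * (A * (g s)^-1 - D * eps s) =
    - D * (deps s + eps s ^+ 2) by ring.
  have h := deps_le s bs.
  rewrite ler0_norm; last by nra.
  have Dle : D * (deps s + c * eps s ^+ 2) <= 0 by rewrite mulr_ge0_le0//; lra.
  rewrite -subr_ge0 -(pmulr_rge0 _ (lt_trans ltr01 c1)).
  have -> : c * (- D * (deps s + eps s ^+ 2) - B * - deps s) =
     - (D * (deps s + c * eps s ^+ 2)) + (B * c - D * (c - 1)) * deps s by ring.
  by rewrite DE subrr mul0r addr0 oppr_ge0.
Qed.

(** Case [-1 < eps_i] and [eps_s < 1]; the supersolution is [C eps]. *)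
Lemma velocity_le_slow (b B c : R) : a < b -> 0 <= c -> c < 1 -> 0 < B ->
  (forall t, b <= t -> `|x t| <= B) ->
  (forall t, b <= t -> `|deps t| <= c * eps t ^+ 2) ->
  exists C, forall t, b <= t -> `|v t| <= C * eps t.
Proof.
move=> ab c0 c1 B0 xB deps_le.
pose C := B * c / (1 - c) + `|v b| / eps b + 1.
have eb := eps_gt0 ab.
have D0 : 0 <= B * c / (1 - c) by rewrite divr_ge0 ?mulr_ge0//; lra.
have vb0 : 0 <= `|v b| / eps b by rewrite divr_ge0// ltW.
have C0 : 0 < C by rewrite /C; lra.
have CE : B * c <= C * (1 - c).
  by rewrite -ler_pdivrMr; rewrite /C; lra.
exists C; apply: (velocity_le (W := fun s => C * eps s)
  (dW := fun s => C * deps s) ab xB) => [s bs|]; last first.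
  rewrite /C 2!mulrDl mul1r (divfK (lt0r_neq0 eb)).
  have := mulr_ge0 D0 (ltW eb); lra.
have as_ := lt_le_trans ab bs; have e0 := eps_gt0 as_.
split; [exact: is_deriveZ (eps_is as_)|exact: mulr_gt0|].
have e2 : 0 < eps s ^+ 2 by rewrite exprn_gt0.
have h := deps_le s bs.
have h1 : B * `|deps s| <= B * (c * eps s ^+ 2) by rewrite ler_wpM2l// ltW.
have h2 : - (c * eps s ^+ 2) <= deps s by have := lerNnormlW h; lra.
have h3 : C * - (c * eps s ^+ 2) <= C * deps s by rewrite ler_wpM2l// ltW.
have h4 : B * c * eps s ^+ 2 <= C * (1 - c) * eps s ^+ 2 by rewrite ler_pM2r.
have -> : eps s * (C * eps s) = C * eps s ^+ 2 by ring.
lra.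
Qed.

(** Case [eps' = - eps^2]: the function [|v|^2 / eps^2 - |x|^2] is
    nonincreasing. *)
Lemma velocity_le_critical (b B : R) : a < b ->
  (forall t, b <= t -> `|x t| <= B) ->
  (forall t, b <= t -> deps t = - eps t ^+ 2) ->
  exists2 C, 0 <= C & forall t, b <= t -> `|v t| <= C * eps t.
Proof.
move=> ab xB depsE.
pose p s := `|v s| ^+ 2 * (eps s ^+ 2)^-1 + - `|x s| ^+ 2.
have p_le t : b <= t -> p t <= p b.
  have dG s : b <= s -> is_derive s 1 (fun u => (eps u ^+ 2)^-1) (2 / eps s).
    move=> bs; have as_ := lt_le_trans ab bs; have e0 := eps_gt0 as_.
    have en0 : eps s != 0 by rewrite gt_eqF.
    have e2 : is_derive s 1 (fun u => eps u ^+ 2) (2 * eps s * deps s).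
      have := is_deriveM (eps_is as_) (eps_is as_).
      rewrite (_ : eps * eps = fun u => eps u ^+ 2); last by apply/funext => u; rewrite expr2.
      by move=> /is_derive_eq; apply; rewrite /GRing.scale/=; ring.
    have := is_deriveV _ e2; rewrite expf_eq0/= => /(_ en0).
    by move=> /is_derive_eq; apply; rewrite /GRing.scale/= depsE//; field.
  have dN s : b <= s -> is_derive s 1 (fun u => - `|x u| ^+ 2) (- (2 * dot (x s) (v s))).
    move=> bs; apply: is_deriveN; apply: (is_derive_sqr_norm dot_norm).
    exact: x_is (lt_le_trans ab bs).
  apply: dini_barrier => // s bs; have as_ := lt_le_trans ab bs; have [cq dq] := velocity_dini as_.
    apply: cvgD; last exact: is_derive_continuous (dN s bs).
    by apply: cvgM => //; exact: is_derive_continuous (dG s bs).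
  move=> _; have e0 := eps_gt0 as_.
  have e20 : 0 < (eps s ^+ 2)^-1 by rewrite invr_gt0 exprn_gt0.
  apply: dini_le_trans (dini_leMD cq dq (dG s bs) e20 (dN s bs)) _.
  by rewrite depsE// le_eqVlt; apply/orP; left; apply/eqP; field; rewrite gt_eqF.
pose K := `|v b| ^+ 2 * (eps b ^+ 2)^-1 + B ^+ 2.
have K0 : 0 <= K by rewrite addr_ge0 ?sqr_ge0// mulr_ge0 ?invr_ge0 ?sqr_ge0.
exists (K + 1) => [|t bt]; first by lra.
have e0 := eps_gt0 (lt_le_trans ab bt).
have := p_le t bt; rewrite /p => h.
have x2 : `|x t| ^+ 2 <= B ^+ 2.
  by rewrite ler_pXn2r ?nnegrE//; [exact: xB|exact: le_trans (xB t bt)].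
have h1 : `|v t| ^+ 2 * (eps t ^+ 2)^-1 <= K by have := sqr_ge0 `|x b|; rewrite /K; lra.
rewrite ler_pdivrMr ?exprn_gt0// in h1.
rewrite -(@ler_pXn2r _ 2) ?nnegrE//; last by rewrite mulr_ge0//; [lra|exact: ltW].
rewrite exprMn (le_trans h1)// ler_wpM2r ?sqr_ge0//; nra.
Qed.

(** With [f = |x - p|^2 - e], the product [f g^2] is nonincreasing from the time
    on at which [<p, x - p> >= - e]; hence [f <= e] eventually. *)
Lemma trajectory_cvg (b : R) (p : H) : a < b -> Zer M p ->
  g t @[t --> +oo] --> +oo ->
  (forall e, 0 < e -> \forall t \near +oo, - e <= dot p (x t - p)) ->
  x t @[t --> +oo] --> p.
Proof.
move=> ab Mp gy xp; apply/cvgrPdistC_le => e0 e0_gt0.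
pose e := e0 ^+ 2 / 2.
have e_gt0 : 0 < e by rewrite divr_gt0// exprn_gt0.
have [T0 [_ T0P]] := xp e e_gt0.
pose T := Num.max b (T0 + 1).
have bT : b <= T by rewrite le_max lexx.
have T0T t : T <= t -> T0 < t.
  by move=> Tt; apply: lt_le_trans Tt; rewrite lt_max ltrDl ltr01 orbT.
pose f t := `|x t - p| ^+ 2 - e.
have decr t : T <= t -> f t * g t ^+ 2 <= f T * g T ^+ 2.
  apply: (derive_le0_le (f := fun t => f t * g t ^+ 2) (df := fun t =>
    2 * dot (x t - p) (v t) * g t ^+ 2 + f t * (2 * eps t * g t ^+ 2))) => s Ts.
  have as_ : a < s by apply: lt_le_trans (le_trans bT Ts).
  split.
    have df : is_derive s 1 f (2 * dot (x s - p) (v s)).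
      have := is_deriveB (is_derive_dist p as_) (is_derive_cst e s 1).
      by rewrite subr0.
    have dg := is_deriveM df (is_deriveM (g_is as_) (g_is as_)).
    rewrite (_ : (fun _ => _) = f * (g * g)); last by apply/funext => u; rewrite expr2.
    by apply: is_derive_eq dg _; rewrite (_ : (g * g) s = g s * g s)// /GRing.scale/=; ring.
  have := dot_dist_velocity as_ Mp; have := T0P s (T0T s Ts); have := eps_gt0 as_.
  rewrite /f; move: (dot (x s - p) _) (dot p _) (`|_| ^+ 2) (eps s) => u w q z z0 we uz.
  rewrite (_ : _ + _ = (2 * u + 2 * z * (q - e)) * g s ^+ 2); last by ring.
  by rewrite mulr_le0_ge0 ?sqr_ge0//; nra.
have /cvgryPge/(_ (Num.max 1 (f T * g T ^+ 2 / e))) gbig := gy.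
near=> t.
have Tt : T <= t by near: t; apply: nbhs_pinfty_ge; rewrite num_real.
have : Num.max 1 (f T * g T ^+ 2 / e) <= g t by near: t; exact: gbig.
rewrite ge_max => /andP[g1 gt].
rewrite ler_pdivrMr// in gt.
have h := decr t Tt.
have g0 := g_gt0 t.
have : f t <= e.
  rewrite -(ler_pM2r (_ : 0 < g t ^+ 2)) ?exprn_gt0// (le_trans h)// (le_trans gt)//.
  by rewrite mulrC (ler_wpM2l (ltW e_gt0))// expr2 ler_peMl// ltW.
rewrite /f lerBlDl => h2.
rewrite -(@ler_pXn2r _ 2) ?nnegrE ?(ltW e0_gt0)//.
apply: le_trans h2 _; rewrite /e; lra.
Unshelve. all: by end_near. Qed.

End asymptotics.

(** * Bounds on the regularization parameter *)

Section bounds_from_ratio.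
Context {R : realType}.
Variables (eps : R -> R) (t0 : R).
Hypothesis eps_gt0 : forall t, t0 <= t -> 0 < eps t.
Local Notation deps := (derive_within `[t0, +oo[ eps).

(** A lower bound on [eps_i] is an upper bound on the derivative of [eps], and
    conversely for [eps_s] below. *)
Lemma eps_i_le (c : R) : (c%:E <= eps_i eps t0)%E ->
  forall t, t0 <= t -> deps t <= - c * eps t ^+ 2.
Proof.
move=> ci t tt; have e0 := eps_gt0 tt.
have : (c%:E <= (eps_ratio eps t0 t)%:E)%E.
  by apply: le_trans ci _; apply: ereal_inf_lbound; exists t => //=; rewrite in_itv/= andbT.
by rewrite lee_fin /eps_ratio ler_pdivlMr ?exprn_gt0// mulNr lerNr.
Qed.

Lemma eps_s_ge (c : R) : (eps_s eps t0 <= c%:E)%E ->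
  forall t, t0 <= t -> - c * eps t ^+ 2 <= deps t.
Proof.
move=> cs t tt; have e0 := eps_gt0 tt.
have : ((eps_ratio eps t0 t)%:E <= c%:E)%E.
  by apply: le_trans cs; apply: ereal_sup_ubound; exists t => //=; rewrite in_itv/= andbT.
by rewrite lee_fin /eps_ratio ler_pdivrMr ?exprn_gt0// mulNr lerNl.
Qed.

Lemma lte_fin_between (c : R) (y : \bar R) : (c%:E < y)%E ->
  exists2 d, c < d & (d%:E <= y)%E.
Proof.
case: y => [y|_|//]; first by rewrite lte_fin => cy; exists y.
by exists (c + 1); rewrite ?ltrDl// leey.
Qed.

Lemma gte_fin_between (c : R) (y : \bar R) : (y < c%:E)%E ->
  exists2 d, d < c & (y <= d%:E)%E.
Proof.
case: y => [y|//|_]; first by rewrite lte_fin => cy; exists y.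
by exists (c - 1); rewrite ?gtrDl ?oppr_lt0// leNye.
Qed.

End bounds_from_ratio.

(** * Rates and strong convergence *)

Theorem theorem2p9 (R : realType) (H : completeNormedModType R)
  (dot : {dot H for idfun}) (dot_norm : norm_induced_by dot)
  (M : H -> H) (M_mono : monotone_op dot M) (M_cont : continuous M)
  (Zer_nonempty : Zer M !=set0)
  (t0 : R) (t0_ge0 : 0 <= t0) (x0 : H)
  (eps : R -> R) (eps_gt0 : forall t, t0 <= t -> 0 < eps t)
  (eps_C1 : continuously_differentiable_on `[t0, +oo[ eps)
  (eps_lim : eps t @[t --> +oo] --> 0)
  (eps_int :
    (\int[@lebesgue_measure R]_(t in `[t0, +oo[) (eps t)%:E = +oo)%E)
  (x : R -> H) (x_sol : trajectory_solution M eps t0 x0 x)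
  (cases :
    [\/ (1%:E < eps_i eps t0)%E,
        [/\ ((-1)%:E < eps_i eps t0)%E, (eps_i eps t0 <= eps_s eps t0)%E
          & (eps_s eps t0 < 1%:E)%E]
      | eps_i eps t0 = 1%:E /\ eps_s eps t0 = 1%:E]) :
  ((1%:E < eps_i eps t0)%E \/ (eps_i eps t0 = 1%:E /\ eps_s eps t0 = 1%:E) ->
    ae_bigO (derive1 x) (fun t => (gamma_eps eps t0 t)^-1) /\
    (fun t => M (x t)) =O_ (pinfty_nbhs R) (fun t => (gamma_eps eps t0 t)^-1)) /\
  ([/\ ((-1)%:E < eps_i eps t0)%E, (eps_i eps t0 <= eps_s eps t0)%E
     & (eps_s eps t0 < 1%:E)%E] ->
    ae_bigO (derive1 x) eps /\ (fun t => M (x t)) =O_ (pinfty_nbhs R) eps) /\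
  x t @[t --> +oo] --> metric_proj (Zer M) 0.
Proof.
set g := gamma_eps eps t0.
pose deps := derive_within `[t0, +oo[ eps.
pose v := velocity M eps x.
(* all estimates start at b, an interior point of the half-line *)
pose b := t0 + 1.
have tb : t0 < b by rewrite ltrDl.
have eps_is t : t0 < t -> is_derive t 1 eps (deps t).
  by move=> tt; exact: quotients_within_derive.
have deps_cont t : t0 < t -> {for t, continuous deps}.
  by move=> tt; exact: derive_within_continuous.
have eps_gt0' t : t0 < t -> 0 < eps t by move/ltW; exact: eps_gt0.
have x_is t : t0 < t -> is_derive t 1 x (v t).
  move=> tt; apply: (strong_solution_is_derive M_cont x_sol.1 tt).
  exact: is_derive_continuous (eps_is t tt).
have g_is t : t0 < t -> is_derive t 1 g (eps t * g t) by move=> tt; exact: is_derive_gamma.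
have g_gt0 t : 0 < g t := gamma_gt0 eps t0 t.
have g_y : g t @[t --> +oo] --> +oo by exact: gamma_cvgy.
clearbody g.
have gV : (g t)^-1 @[t --> +oo] --> (0 : R).
  by apply/gtr0_cvgV0 => //; exact: nearW.
have [B B0 xB] := trajectory_bounded dot_norm M_mono x_is eps_gt0' tb Zer_nonempty.
have bt t : b <= t -> t0 < t by exact: lt_le_trans.
(* a rate h for the velocity is a rate for M x = - v - eps x as soon as eps is
   dominated by h *)
have transfer (h : R -> R) (C D : R) : 0 <= D ->
    (forall t, b <= t -> 0 <= h t) ->
    (forall t, b <= t -> `|v t| <= C * h t) ->
    (forall t, b <= t -> eps t <= D * h t) ->
    h t @[t --> +oo] --> (0 : R) ->
    [/\ ae_bigO (derive1 x) h, (fun t => M (x t)) =O_ (pinfty_nbhs R) h &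
        M (x t) @[t --> +oo] --> (0 : H)].
  move=> D0 h0 vh eh hlim.
  have Mh t : b <= t -> `|M (x t)| <= (C + D * B) * h t.
    move=> tb'.
    have -> : M (x t) = - v t - eps t *: x t by rewrite /v /velocity opprK addrK.
    rewrite (le_trans (ler_normB _ _))// normrN normrZ (gtr0_norm (eps_gt0' _ (bt _ tb'))).
    rewrite mulrDl lerD ?vh// mulrAC ler_pM ?eh ?xB//.
    exact/ltW/eps_gt0'/bt.
  have Mabs t : b <= t -> `|M (x t)| <= (`|C| + D * B + 1) * h t.
    move=> tb'; apply: le_trans (Mh t tb') _; rewrite ler_wpM2r ?h0//.
    by have := ler_norm C; lra.
  split.
  - exists C, b; apply: aeW => t tb'.
    have [_ dx] := x_is t (bt t tb').
    by rewrite derive1E dx ger0_norm ?h0// vh.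
  - apply/eqO_exP; exists (`|C| + D * B + 1).
      by have := normr_ge0 C; have := mulr_ge0 D0 (ltW B0); lra.
    near=> t; have tb' : b <= t by near: t; apply: nbhs_pinfty_ge; rewrite num_real.
    rewrite (ger0_norm (h0 t tb')); exact: Mabs.
  - apply/norm_cvg0P.
    have lim : (`|C| + D * B + 1) * h t @[t --> +oo] --> (`|C| + D * B + 1) * (0 : R).
      exact: cvgMl_tmp.
    rewrite mulr0 in lim.
    apply: (squeeze_cvgr _ (cvg_cst 0) lim); near=> t.
    have tb' : b <= t by near: t; apply: nbhs_pinfty_ge; rewrite num_real.
    by rewrite normr_ge0 Mabs.
have eps_gamma : (forall s, b <= s -> deps s <= - eps s ^+ 2) ->
    forall t, b <= t -> eps t <= eps b * g b * (g t)^-1.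
  move=> depsle t tb'; rewrite ler_pdivlMr//.
  exact: (eps_gamma_le eps_is g_is g_gt0 tb depsle tb').
have eg0 : 0 <= eps b * g b by rewrite mulr_ge0// ltW// eps_gt0'.
have gV0 t : b <= t -> 0 <= (g t)^-1 by move=> _; rewrite invr_ge0 (ltW (g_gt0 t)).
have fast : (1%:E < eps_i eps t0)%E \/ (eps_i eps t0 = 1%:E /\ eps_s eps t0 = 1%:E) ->
    [/\ ae_bigO (derive1 x) (fun t => (g t)^-1),
        (fun t => M (x t)) =O_ (pinfty_nbhs R) (fun t => (g t)^-1) &
        M (x t) @[t --> +oo] --> (0 : H)].
  case=> [/lte_fin_between[c c1 ci]|[i1 s1]].
    have dle t : b <= t -> deps t <= - c * eps t ^+ 2.
      by move=> /bt/ltW; exact: eps_i_le.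
    have [C vC] := velocity_le_fast dot_norm M_mono M_cont x_is eps_is
      deps_cont eps_gt0' g_is g_gt0 tb c1 B0 xB dle.
    apply: (transfer _ C (eps b * g b)) => //.
    apply: eps_gamma => s bs; apply: le_trans (dle s bs) _.
    by rewrite -[leRHS]mulN1r ler_wpM2r ?sqr_ge0// lerN2 ltW.
  have dE t : b <= t -> deps t = - eps t ^+ 2.
    move=> /bt/ltW tt; rewrite -mulN1r; apply/eqP; rewrite eq_le.
    by rewrite (eps_i_le eps_gt0) ?i1//= (eps_s_ge eps_gt0) ?s1.
  have [C C0 vC] := velocity_le_critical dot_norm M_mono M_cont x_is eps_is
      deps_cont eps_gt0' tb xB dE.
  have eg : forall t, b <= t -> eps t <= eps b * g b * (g t)^-1.
    by apply: eps_gamma => s bs; rewrite dE.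
  apply: (transfer _ (C * (eps b * g b)) (eps b * g b)) => // t tb'.
  by rewrite (le_trans (vC t tb'))// -mulrA ler_wpM2l// eg.
have slow : [/\ ((-1)%:E < eps_i eps t0)%E, (eps_i eps t0 <= eps_s eps t0)%E
     & (eps_s eps t0 < 1%:E)%E] ->
    [/\ ae_bigO (derive1 x) eps, (fun t => M (x t)) =O_ (pinfty_nbhs R) eps &
        M (x t) @[t --> +oo] --> (0 : H)].
  move=> [/lte_fin_between[c1 c1N ci] _ /gte_fin_between[c2 c2l cs]].
  pose c := Num.max 0 (Num.max (- c1) c2).
  have [C vC] : exists C, forall t, b <= t -> `|v t| <= C * eps t.
    apply: (@velocity_le_slow _ _ _ dot_norm M x eps deps t0 M_mono M_cont x_is eps_is deps_cont
      eps_gt0' b B c) => //.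
    - by rewrite le_max lexx.
    - by rewrite !gt_max ltr01 c2l andbT ltrNl.
    - move=> t tb'; have e2 := sqr_ge0 (eps t).
      have := eps_i_le eps_gt0 ci (ltW (bt t tb')).
      have := eps_s_ge eps_gt0 cs (ltW (bt t tb')).
      rewrite -/deps => h1 h2; rewrite ler_norml.
      have : c2 * eps t ^+ 2 <= c * eps t ^+ 2.
        by rewrite ler_wpM2r// !le_max lexx !orbT.
      have : - c1 * eps t ^+ 2 <= c * eps t ^+ 2.
        by rewrite ler_wpM2r// !le_max lexx !orbT.
      by lra.
  apply: (transfer _ C 1) => // t tb'; first exact/ltW/eps_gt0'/bt.
  by rewrite mul1r.
have Mx0 : M (x t) @[t --> +oo] --> (0 : H).
  by case: cases => [h|h|h]; [have [] := fast (or_introl h)|have [] := slow h|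
    have [] := fast (or_intror h)].
split; first by move=> /fast[].
split; first by move=> /slow[].
have [Mp pmin] := metric_proj_Zer dot_norm M_mono M_cont Zer_nonempty.
apply: (trajectory_cvg dot_norm M_mono x_is eps_gt0' g_is g_gt0 tb Mp g_y).
apply: (near_dot_ge dot_norm M_mono M_cont xB Mx0).
exact: (min_norm_dot_ge0 dot_norm M_mono M_cont Mp pmin).
Unshelve. all: by end_near. Qed.
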